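(* Let $0<\alpha<\pi/6$, let $T$ be the Feres Random Map on $[0,\pi]$ with parameter $\alpha$, let $\mu(A)=\frac12\int_A\sin\theta\,d\theta$ for Borel $A\subset[0,\pi]$, and let $\nu$ be a probability measure on the Borel sets of $[0,\pi]$ with $\nu\ll\mu$. Then $\nu^{(n)}(A)\to\mu(A)$ for all Borel sets $A\subset[0,\pi]$ if and only if $\frac{\alpha}{\pi}$ is an irrational number.
   Context: Feres Random Map. Fix $0<\alpha<\pi/6$. Put $T_1(\theta)=\theta+2\alpha$, $T_2(\theta)=-\theta+2\pi-4\alpha$, $T_3(\theta)=\theta-2\alpha$, $T_4(\theta)=-\theta+4\alpha$, and $u_a(\theta)=\frac12\left(1+\frac{\tan a}{\tan\theta}\right)$ (with $1/\tan(\pi/2)=0$). Define functions $p_i:[0,\pi]\to[0,1]$ by: $p_1(\theta)=1$ on $[0,\alpha)$, $u_\alpha(\theta)$ on $[\alpha,\pi-3\alpha)$, $2\cos(2\alpha)u_{2\alpha}(\theta)$ on $[\pi-3\alpha,\pi-2\alpha)$, $0$ on $[\pi-2\alpha,\pi]$; $p_2(\theta)=0$ on $[0,\pi-3\alpha)$, $u_\alpha(\theta)-2\cos(2\alpha)u_{2\alpha}(\theta)$ on $[\pi-3\alpha,\pi-2\alpha)$, $u_\alpha(\theta)$ on $[\pi-2\alpha,\pi-\alpha)$, $0$ on $[\pi-\alpha,\pi]$; $p_3(\theta)=0$ on $[0,2\alpha)$, $2\cos(2\alpha)u_{2\alpha}(-\theta)$ on $[2\alpha,3\alpha)$, $u_\alpha(-\theta)$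 on $[3\alpha,\pi-\alpha)$, $1$ on $[\pi-\alpha,\pi]$; $p_4(\theta)=0$ on $[0,\alpha)$, $u_\alpha(-\theta)$ on $[\alpha,2\alpha)$, $u_\alpha(-\theta)-2\cos(2\alpha)u_{2\alpha}(-\theta)$ on $[2\alpha,3\alpha)$, $0$ on $[3\alpha,\pi]$. The Feres Random Map $T$ sends $\theta$ to $T_i(\theta)$ with probability $p_i(\theta)$, $i=1,2,3,4$. Its transition kernel is $K(\theta,A)=\sum_{i=1}^4 p_i(\theta)\mathbf 1_A(T_i(\theta))$. Evolution of measures. For a Borel probability measure $\nu$ on $[0,\pi]$ set $\nu^{(0)}=\nu$ and $\nu^{(n+1)}(A)=\int_{[0,\pi]}K(\theta,A)\,d\nu^{(n)}(\theta)$ for $n\ge 0$.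
   Formalization: For one fixed ν the equivalence fails (ν = μ is invariant for every α, e.g. α = π/7), so it is read as: ν^(n)(A)→μ(A) for every probability ν≪μ and every Borel A, if and only if α/π is irrational; for rational α/π this claims only that convergence fails for some ν. *)

(* Defs.v *)
From HB Require Import structures.
From mathcomp Require Import all_boot all_order all_algebra.
From mathcomp Require Import all_classical all_reals all_analysis.

Set Implicit Arguments.
Unset Strict Implicit.
Unset Printing Implicit Defensive.

Import Order.TTheory GRing.Theory Num.Theory.
Import numFieldNormedType.Exports.

Local Open Scope classical_set_scope.
Local Open Scope ring_scope.

(* The state space [0, pi] is the subset `[0, pi] of the Borel space
   [measurableTypeR R]: the maps and weights below are total on [R], but only
   their values on [0, pi] enter the evolution. *)

Definition feres_T1 (R : realType) (alpha theta : R) : R := theta + 2 * alpha.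
Definition feres_T2 (R : realType) (alpha theta : R) : R :=
  - theta + 2 * pi - 4 * alpha.
Definition feres_T3 (R : realType) (alpha theta : R) : R := theta - 2 * alpha.
Definition feres_T4 (R : realType) (alpha theta : R) : R :=
  - theta + 4 * alpha.

(* Since [cos (pi / 2) = 0] and [x / 0 = 0], [tan (pi / 2) = 0] and its inverse
   is [0], so the convention 1 / tan (pi / 2) = 0 holds as stated. *)
Definition feres_u (R : realType) (a theta : R) : R :=
  2^-1 * (1 + tan a / tan theta).

Definition feres_p1 (R : realType) (alpha theta : R) : R :=
  if theta < alpha then 1
  else if theta < pi - 3 * alpha then feres_u alpha theta
  else if theta < pi - 2 * alpha then
    2 * cos (2 * alpha) * feres_u (2 * alpha) theta
  else 0.

Definition feres_p2 (R : realType) (alpha theta : R) : R :=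
  if theta < pi - 3 * alpha then 0
  else if theta < pi - 2 * alpha then
    feres_u alpha theta - 2 * cos (2 * alpha) * feres_u (2 * alpha) theta
  else if theta < pi - alpha then feres_u alpha theta
  else 0.

Definition feres_p3 (R : realType) (alpha theta : R) : R :=
  if theta < 2 * alpha then 0
  else if theta < 3 * alpha then
    2 * cos (2 * alpha) * feres_u (2 * alpha) (- theta)
  else if theta < pi - alpha then feres_u alpha (- theta)
  else 1.

Definition feres_p4 (R : realType) (alpha theta : R) : R :=
  if theta < alpha then 0
  else if theta < 2 * alpha then feres_u alpha (- theta)
  else if theta < 3 * alpha then
    feres_u alpha (- theta)
    - 2 * cos (2 * alpha) * feres_u (2 * alpha) (- theta)
  else 0.

Definition feres_kernel (R : realType) (alpha theta : R)
    (A : set (measurableTypeR R)) : \bar R :=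
  (feres_p1 alpha theta * \1_A (feres_T1 alpha theta)
   + feres_p2 alpha theta * \1_A (feres_T2 alpha theta)
   + feres_p3 alpha theta * \1_A (feres_T3 alpha theta)
   + feres_p4 alpha theta * \1_A (feres_T4 alpha theta))%:E.

Fixpoint feres_evolve (R : realType) (alpha : R)
    (nu : set (measurableTypeR R) -> \bar R) (n : nat) :
    set (measurableTypeR R) -> \bar R :=
  if n is m.+1 then
    fun A => (\int[feres_evolve alpha nu m]_(theta in `[0%R, pi])
                feres_kernel alpha theta A)%E
  else nu.

(* Intersecting with [0, pi] makes this a nonnegative set function on all Borel
   sets of [R]; it is 1/2 times the integral of sin over [A] when [A] is
   contained in [0, pi]. *)
Definition feres_mu (R : realType) (A : set (measurableTypeR R)) : \bar R :=
  ((2^-1)%:E *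
   \int[@lebesgue_measure R]_(theta in A `&` `[0%R, pi]) (sin theta)%:E)%E.

(* Main.v *)
(** Let [P f x = sum_i p_i(x) f(T_i x)].  The weights [p_i(x) sin x] satisfy
    detailed balance (branch 1 is undone by 3, branches 2 and 4 are
    involutions), so [P] is self-adjoint in [L^2(sin x dx)] and
    [|f|^2 - |P f|^2] is the integral of the variance of [f] over one step.

    If [alpha / pi = p / q], every [T_i] preserves [cos (q x)], hence
    [{cos (q x) > 0}] is invariant and initial laws inside and outside of it
    have different limits.

    If [alpha / pi] is irrational, let [h = 1_A - mu A] and [f_n = P^n h].
    Self-adjointness gives
    [|f_2n - f_2k|^2 = |f_2n|^2 + |f_2k|^2 - 2 |f_(n+k)|^2], and [|f_n|]
    decreases, so the primitives of [f_2n] converge to some [F] on [[0, pi]].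
    The one-step variances tend to 0, so the branches taken from a common point
    become indistinguishable in the limit: increments of [F] are invariant
    under [x |-> x + 4 alpha], and under [x |-> 6 alpha - x] and
    [x |-> 2 pi - 6 alpha - x] near the end points.  Extended by periodicity,
    [F] minus a linear function has the incommensurable periods [4 alpha] and
    [2 pi], so [F] is linear, and linear with slope 0 because [f_n] has mean 0.
    Thus [f_2n] tends weakly to 0, and [|f_n|^2 = <f_2n, h>] tends to 0.
    Absolute continuity of [nu] turns this into [int f_n dnu -> 0]. *)

Require Import Defs.
From HB Require Import structures.
From mathcomp Require Import all_boot all_order all_algebra.
From mathcomp Require Import all_classical all_reals all_analysis.
From mathcomp Require Import measurable_realfun.
From mathcomp Require Import ring lra.

Set Implicit Arguments.
Unset Strict Implicit.
Unset Printing Implicit Defensive.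

Import Order.TTheory GRing.Theory Num.Theory.
Import numFieldNormedType.Exports.

Local Open Scope classical_set_scope.
Local Open Scope ring_scope.

(** * Transition weights *)

(** The main obstacle is the degenerate weight. Both sin and the products p_i p_j may vanish at the
    ends of the intervals in question, and 1 / sin is not integrable on [0, pi], so Cauchy-Schwarz
    does not pass from small weighted squares to small Lebesgue integrals; the density of [nu] is
    moreover only integrable. [small_of_weighted_square] makes this passage, using only the common
    bound on the iterates. Even iterates appear because the cross term of two of them has even total
    index and is therefore again a squared norm; an odd index would leave a possible alternation of
    sign uncontrolled. Primitives are used because vanishing variances give identities only in the
    mean: integrated over intervals, they become identities between values of [F] at points. No
    single pair of branches provides the period 2 pi. It comes from composing the reflections about
    3 alpha and pi - 3 alpha, a translation by 2 pi - 12 alpha, which is 2 pi modulo the period 4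
    alpha. *)

Section Weights.
Context {R : realType}.
Variable a : R.
Hypotheses (a_gt0 : 0 < a) (a_lt : 6 * a < pi).

Local Notation p1 := (feres_p1 a).
Local Notation p2 := (feres_p2 a).
Local Notation p3 := (feres_p3 a).
Local Notation p4 := (feres_p4 a).
Local Notation T1 := (feres_T1 a).
Local Notation T2 := (feres_T2 a).
Local Notation T3 := (feres_T3 a).
Local Notation T4 := (feres_T4 a).

Local Ltac alra := move: (a_gt0) (a_lt) => ? ?; lra.

Lemma cos_small_gt0 (b : R) : 0 <= b -> 2 * b < pi -> 0 < cos b.
Proof. by move=> b0 bpi; apply: cos_gt0_pihalf; apply/andP; split; lra. Qed.

Let cosa_gt0 : 0 < cos a. Proof. by apply: cos_small_gt0; alra. Qed.
Let cos2a_gt0 : 0 < cos (2 * a). Proof. by apply: cos_small_gt0; alra. Qed.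

(** [invf_div] turns 1 / tan x into cos x / sin x even where the cosine vanishes, so pi / 2 needs no
    separate case. The rest is the addition formula. *)
Lemma sinM_feres_u (b x : R) : 0 < cos b -> sin x != 0 ->
  sin x * feres_u b x = sin (x + b) / (2 * cos b).
Proof.
move=> cb sx; rewrite /feres_u /tan invf_div sinD.
have cb0 : cos b != 0 by rewrite gt_eqF.
by field; rewrite cb0.
Qed.

Lemma sinM_feres_uN (b x : R) : 0 < cos b -> sin x != 0 ->
  sin x * feres_u b (- x) = sin (x - b) / (2 * cos b).
Proof.
move=> cb sx; rewrite /feres_u /tan sinN cosN invf_div sinB invrN.
have cb0 : cos b != 0 by rewrite gt_eqF.
by field; rewrite cb0.
Qed.

Lemma feres_u_compl (b x : R) : feres_u b x + feres_u b (- x) = 1.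
Proof. by rewrite /feres_u /tan sinN cosN mulNr !invrN mulrN; lra. Qed.

(** Extension by zero lets detailed balance hold at every real point, so that changes of variables
    take place on the whole line without boundary terms. *)
Definition sin_weight (x : R) : R := if (0 <= x) && (x <= pi) then sin x else 0.
Local Notation S := sin_weight.

(** The functions [w1] to [w4] are the weights multiplied by the sine. The quotients of tangents
    disappear, and positivity and detailed balance become comparisons of single sine terms. *)
Let w1 (x : R) : R := if x < a then sin x
  else if x < pi - 3 * a then sin (x + a) / (2 * cos a)
  else if x < pi - 2 * a then sin (x + 2 * a) else 0.
Let w2 (x : R) : R := if x < pi - 3 * a then 0
  else if x < pi - 2 * a then - sin (x + 3 * a) / (2 * cos a)
  else if x < pi - a then sin (x + a) / (2 * cos a) else 0.
Let w3 (x : R) : R := if x < 2 * a then 0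
  else if x < 3 * a then sin (x - 2 * a)
  else if x < pi - a then sin (x - a) / (2 * cos a) else sin x.
Let w4 (x : R) : R := if x < a then 0
  else if x < 2 * a then sin (x - a) / (2 * cos a)
  else if x < 3 * a then - sin (x - 3 * a) / (2 * cos a) else 0.

Let sin_neq0 (x : R) : 0 < x -> x < pi -> sin x != 0.
Proof. by move=> x0 xpi; rewrite gt_eqF// sin_gt0_pi// x0. Qed.

(** Product-to-sum formula: it collapses the difference in the middle piece of [feres_p2] to one
    sine, as [sin_2aN] does for [feres_p4]. *)
Let sin_2a (x : R) : 2 * cos a * sin (x + 2 * a) = sin (x + a) + sin (x + 3 * a).
Proof.
have -> : x + a = (x + 2 * a) - a by ring.
have -> : x + 3 * a = (x + 2 * a) + a by ring.
by rewrite (sinB (x + 2 * a)) (sinD (x + 2 * a)); ring.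
Qed.

Let sin_2aN (x : R) : 2 * cos a * sin (x - 2 * a) = sin (x - a) + sin (x - 3 * a).
Proof.
have -> : x - a = (x - 2 * a) + a by ring.
have -> : x - 3 * a = (x - 2 * a) - a by ring.
by rewrite (sinB (x - 2 * a)) (sinD (x - 2 * a)); ring.
Qed.

Let cosa0 : cos a != 0. Proof. by rewrite gt_eqF. Qed.
Let cos2a0 : cos (2 * a) != 0. Proof. by rewrite gt_eqF. Qed.

Lemma sinM_p1 (x : R) : 0 <= x <= pi -> sin x * p1 x = w1 x.
Proof.
move=> /andP[x0 xpi]; rewrite /w1 /feres_p1.
case: ltP => h1; first by rewrite mulr1.
case: ltP => h2; first by rewrite sinM_feres_u//; apply: sin_neq0; alra.
case: ltP => h3; last by rewrite mulr0.
rewrite mulrCA sinM_feres_u//; last by apply: sin_neq0; alra.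
by field.
Qed.

Lemma sinM_p2 (x : R) : 0 <= x <= pi -> sin x * p2 x = w2 x.
Proof.
move=> /andP[x0 xpi]; rewrite /w2 /feres_p2.
case: ltP => h1; first by rewrite mulr0.
case: ltP => h2; last first.
  case: ltP => h3; last by rewrite mulr0.
  by rewrite sinM_feres_u//; apply: sin_neq0; alra.
have sx : sin x != 0 by apply: sin_neq0; alra.
rewrite mulrBr (mulrCA (sin x) (2 * cos (2 * a))) !sinM_feres_u//.
have -> : 2 * cos (2 * a) * (sin (x + 2 * a) / (2 * cos (2 * a))) = sin (x + 2 * a).
  by field.
rewrite (_ : sin (x + 2 * a) = (sin (x + a) + sin (x + 3 * a)) / (2 * cos a)).
  by field.
by rewrite -sin_2a; field.
Qed.

Lemma sinM_p3 (x : R) : 0 <= x <= pi -> sin x * p3 x = w3 x.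
Proof.
move=> /andP[x0 xpi]; rewrite /w3 /feres_p3.
case: ltP => h1; first by rewrite mulr0.
case: ltP => h2.
  rewrite mulrCA sinM_feres_uN//; last by apply: sin_neq0; alra.
  by field.
case: ltP => h3; last by rewrite mulr1.
by rewrite sinM_feres_uN//; apply: sin_neq0; alra.
Qed.

Lemma sinM_p4 (x : R) : 0 <= x <= pi -> sin x * p4 x = w4 x.
Proof.
move=> /andP[x0 xpi]; rewrite /w4 /feres_p4.
case: ltP => h1; first by rewrite mulr0.
case: ltP => h2; first by rewrite sinM_feres_uN//; apply: sin_neq0; alra.
case: ltP => h3; last by rewrite mulr0.
have sx : sin x != 0 by apply: sin_neq0; alra.
rewrite mulrBr (mulrCA (sin x) (2 * cos (2 * a))) !sinM_feres_uN//.
have -> : 2 * cos (2 * a) * (sin (x - 2 * a) / (2 * cos (2 * a))) = sin (x - 2 * a).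
  by field.
rewrite (_ : sin (x - 2 * a) = (sin (x - a) + sin (x - 3 * a)) / (2 * cos a)).
  by field.
by rewrite -sin_2aN; field.
Qed.

Let sin_gt0 (x : R) : 0 < x -> x < pi -> 0 < sin x.
Proof. by move=> x0 xpi; apply: sin_gt0_pi; rewrite x0. Qed.
Let sinN_gt0 (x : R) : pi < x -> x < 2 * pi -> 0 < - sin x.
Proof.
move=> x0 xpi; have -> : x = (x - pi) + pi by ring.
by rewrite sinDpi opprK sin_gt0//; alra.
Qed.
Let sinN_gt0' (x : R) : - pi < x -> x < 0 -> 0 < - sin x.
Proof. by move=> x0 xpi; rewrite -sinN sin_gt0//; alra. Qed.

Lemma feres_p1_gt0 (x : R) : 0 < x -> x < pi - 2 * a -> 0 < p1 x.
Proof.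
move=> x0 xpi; have sx : 0 < sin x by apply: sin_gt0; alra.
rewrite -(pmulr_rgt0 _ sx) sinM_p1; last by alra.
rewrite /w1; case: (ltP x _) => h1//; case: (ltP x _) => h2.
  by rewrite divr_gt0 ?mulr_gt0// sin_gt0//; alra.
by rewrite xpi sin_gt0//; alra.
Qed.

Lemma feres_p2_gt0 (x : R) : pi - 3 * a < x -> x < pi - a -> 0 < p2 x.
Proof.
move=> x0 xpi; have sx : 0 < sin x by apply: sin_gt0; alra.
rewrite -(pmulr_rgt0 _ sx) sinM_p2; last by alra.
rewrite /w2; case: (ltP x _) => h1; first by alra.
case: (ltP x _) => h2; rewrite ?xpi divr_gt0 ?mulr_gt0//.
  by apply: sinN_gt0; alra.
by rewrite sin_gt0//; alra.
Qed.

Lemma feres_p3_gt0 (x : R) : 2 * a < x -> x < pi -> 0 < p3 x.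
Proof.
move=> x0 xpi; have sx : 0 < sin x by apply: sin_gt0; alra.
rewrite -(pmulr_rgt0 _ sx) sinM_p3; last by alra.
rewrite /w3; case: (ltP x _) => h1; first by alra.
case: (ltP x _) => h2; first by rewrite sin_gt0//; alra.
case: (ltP x _) => h3//; rewrite divr_gt0 ?mulr_gt0//.
by rewrite sin_gt0//; alra.
Qed.

Lemma feres_p4_gt0 (x : R) : a < x -> x < 3 * a -> 0 < p4 x.
Proof.
move=> x0 xpi; have sx : 0 < sin x by apply: sin_gt0; alra.
rewrite -(pmulr_rgt0 _ sx) sinM_p4; last by alra.
rewrite /w4; case: (ltP x _) => h1; first by alra.
case: (ltP x _) => h2; rewrite ?xpi divr_gt0 ?mulr_gt0//.
  by rewrite sin_gt0//; alra.
by apply: sinN_gt0'; alra.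
Qed.

(** Outside [0, pi] each weight is constantly 0 or 1, so the sign holds on the whole line and
    [feres_op] is an average at every real point. *)
Lemma feres_p1_ge0 (x : R) : 0 <= p1 x.
Proof.
have [x0|x0] := leP x 0; first by rewrite /feres_p1 (_ : x < a)//; alra.
have [xpi|xpi] := ltP x (pi - 2 * a); first exact/ltW/feres_p1_gt0.
by rewrite /feres_p1; do 3 case: (ltP x _) => //; alra.
Qed.

Lemma feres_p3_ge0 (x : R) : 0 <= p3 x.
Proof.
have [x0|x0] := leP pi x.
  by rewrite /feres_p3; do 3 case: (ltP x _) => //; alra.
have [xpi|xpi] := ltP (2 * a) x; first exact/ltW/feres_p3_gt0.
have [x2a|x2a] := ltP x (2 * a); first by rewrite /feres_p3 x2a.
have {x2a xpi} -> : x = 2 * a by alra.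
rewrite /feres_p3 ltxx (_ : 2 * a < 3 * a); last by alra.
rewrite -(@pmulr_rge0 _ (sin (2 * a))); last by rewrite sin_gt0//; alra.
rewrite mulrCA sinM_feres_uN//; last by apply: sin_neq0; alra.
by rewrite subrr sin0 mul0r mulr0.
Qed.

Lemma feres_p2_ge0 (x : R) : 0 <= p2 x.
Proof.
have [x0|x0] := leP (pi - a) x.
  by rewrite /feres_p2; do 3 case: (ltP x _) => //; alra.
have [xpi|xpi] := ltP (pi - 3 * a) x; first exact/ltW/feres_p2_gt0.
have [x2a|x2a] := ltP x (pi - 3 * a); first by rewrite /feres_p2 x2a.
have sx : 0 < sin x by apply: sin_gt0; alra.
rewrite -(pmulr_rge0 _ sx) sinM_p2; last by alra.
have {x2a xpi x0 sx} -> : x = pi - 3 * a by alra.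
rewrite /w2 ltxx (_ : _ < pi - 2 * a); last by alra.
by rewrite subrK sinpi oppr0 mul0r.
Qed.

Lemma feres_p4_ge0 (x : R) : 0 <= p4 x.
Proof.
have [x0|x0] := leP (3 * a) x.
  by rewrite /feres_p4; do 3 case: (ltP x _) => //; alra.
have [xpi|xpi] := ltP a x; first exact/ltW/feres_p4_gt0.
have [x2a|x2a] := ltP x a; first by rewrite /feres_p4 x2a.
have {x2a xpi x0} -> : x = a by alra.
rewrite /feres_p4 ltxx (_ : a < 2 * a); last by alra.
rewrite -(@pmulr_rge0 _ (sin a)); last by rewrite sin_gt0//; alra.
rewrite sinM_feres_uN//; last by apply: sin_neq0; alra.
by rewrite subrr sin0 mul0r.
Qed.

Lemma feres_p_sum (x : R) : p1 x + p2 x + p3 x + p4 x = 1.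
Proof.
have u1 := feres_u_compl a x; have u2 := feres_u_compl (2 * a) x.
rewrite /feres_p1 /feres_p2 /feres_p3 /feres_p4.
by repeat (case: (ltP x _) => ?; try by exfalso; alra); alra.
Qed.

Lemma feres_T1_stays (x : R) : 0 <= x <= pi -> p1 x != 0 -> 0 <= T1 x <= pi.
Proof.
move=> /andP[x0 xpi]; rewrite /feres_p1 /feres_T1.
by repeat (case: (ltP x _) => ?); rewrite ?eqxx// => _; apply/andP; split; alra.
Qed.

Lemma feres_T2_stays (x : R) : 0 <= x <= pi -> p2 x != 0 -> 0 <= T2 x <= pi.
Proof.
move=> /andP[x0 xpi]; rewrite /feres_p2 /feres_T2.
by repeat (case: (ltP x _) => ?); rewrite ?eqxx// => _; apply/andP; split; alra.
Qed.

Lemma feres_T3_stays (x : R) : 0 <= x <= pi -> p3 x != 0 -> 0 <= T3 x <= pi.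
Proof.
move=> /andP[x0 xpi]; rewrite /feres_p3 /feres_T3.
by repeat (case: (ltP x _) => ?); rewrite ?eqxx// => _; apply/andP; split; alra.
Qed.

Lemma feres_T4_stays (x : R) : 0 <= x <= pi -> p4 x != 0 -> 0 <= T4 x <= pi.
Proof.
move=> /andP[x0 xpi]; rewrite /feres_p4 /feres_T4.
by repeat (case: (ltP x _) => ?); rewrite ?eqxx// => _; apply/andP; split; alra.
Qed.

(** The break points of [feres_p1], shifted by 2 alpha, are those of [feres_p3]. If only one of x
    and [T1 x] lies in [0, pi], the weight of the branch that would leave the interval is 0. *)
Lemma detailed_balance13 (x : R) : S x * p1 x = S (T1 x) * p3 (T1 x).
Proof.
rewrite /sin_weight /feres_T1.
case: ifPn => [hx|/nandP hx]; case: ifPn => [hy|/nandP hy];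
  rewrite ?mul0r// ?(sinM_p1 hx) ?(sinM_p3 hy).
- move: hx hy => /andP[? ?] /andP[? ?].
  rewrite /w1 /w3; repeat (case: ltP => ?); try (exfalso; alra).
  + by congr (sin _); ring.
  + by congr (sin _ / _); ring.
  + by [].
  (* Here x = pi - 2 alpha: branch 1 is already closed, and branch 3 has weight 1 but the sine at pi
     is 0. *)
  + by rewrite (_ : x + 2 * a = pi) ?sinpi//; alra.
- move: hx hy; rewrite -!ltNge => /andP[? ?] [] ?; first by exfalso; alra.
  by rewrite /w1; repeat (case: ltP => ?) => //; exfalso; alra.
- move: hx hy; rewrite -!ltNge => [] [] ? /andP[? ?]; last by exfalso; alra.
  by rewrite /w3; repeat (case: ltP => ?) => //; exfalso; alra.
Qed.

Let inside (x : R) : 0 <= x -> x <= pi -> (0 <= x) && (x <= pi).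
Proof. by move=> -> ->. Qed.

Let weight2_out (x : R) : x <= pi - 3 * a \/ pi - a <= x -> S x * p2 x = 0.
Proof.
move=> xout; rewrite /sin_weight; case: ifP => [hx|_]; last exact: mul0r.
rewrite sinM_p2// /w2; case: xout => hx'; last first.
  by rewrite !ifF//; apply/negbTE; rewrite -leNgt; alra.
case: (ltP x (pi - 3 * a)) => // hx''; have -> : x = pi - 3 * a by alra.
by rewrite ifT; [rewrite subrK sinpi oppr0 mul0r|alra].
Qed.

(** With [weight2_high], this shows the weight as a hump on [pi - 3 alpha, pi - alpha], symmetric
    about the fixed point pi - 2 alpha of [T2]. Both formulas are valid on closed intervals, so the
    reflection exchanges them exactly. [weight4_low] and [weight4_high] do the same about 2
    alpha. *)
Let weight2_low (x : R) : pi - 3 * a <= x -> x <= pi - 2 * a ->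
  S x * p2 x = sin (x - (pi - 3 * a)) / (2 * cos a).
Proof.
move=> x1 x2; have x0 : (0 <= x) && (x <= pi) by apply: inside; alra.
rewrite /sin_weight x0 sinM_p2// /w2 ifF; last by apply/negbTE; rewrite -leNgt.
have e : - sin (x + 3 * a) = sin (x - (pi - 3 * a)).
  by rewrite (_ : x + 3 * a = (x - (pi - 3 * a)) + pi) ?sinDpi ?opprK//; ring.
case: (ltP x (pi - 2 * a)) => h; first by rewrite e.
have xE : x = pi - 2 * a by alra.
rewrite ifT; last by alra.
rewrite -e xE (_ : pi - 2 * a + a = - a + pi); last by ring.
by rewrite (_ : pi - 2 * a + 3 * a = a + pi) ?sinDpi ?sinN//; ring.
Qed.

Let weight2_high (x : R) : pi - 2 * a <= x -> x <= pi - a ->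
  S x * p2 x = sin (pi - a - x) / (2 * cos a).
Proof.
move=> x1 x2; have x0 : (0 <= x) && (x <= pi) by apply: inside; alra.
rewrite /sin_weight x0 sinM_p2// /w2 ifF; last by apply/negbTE; rewrite -leNgt; alra.
rewrite ifF; last by apply/negbTE; rewrite -leNgt.
have e : sin (x + a) = sin (pi - a - x).
  by rewrite (_ : pi - a - x = - (x + a) + pi) ?sinDpi ?sinN ?opprK//; ring.
case: (ltP x (pi - a)) => h; first by rewrite e.
have -> : x = pi - a by alra.
by rewrite subrr sin0 mul0r.
Qed.

Lemma detailed_balance22 (x : R) : S x * p2 x = S (T2 x) * p2 (T2 x).
Proof.
rewrite /feres_T2; have [h1|h1] := leP x (pi - 3 * a).
  by rewrite !weight2_out//; [right|left]; alra.
have [h2|h2] := leP (pi - a) x.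
  by rewrite !weight2_out//; [left|right]; alra.
have [h3|h3] := leP x (pi - 2 * a).
  rewrite weight2_low//; [|alra..]; rewrite weight2_high; [|alra..].
  by congr (sin _ / _); ring.
rewrite weight2_high//; [|alra..]; rewrite weight2_low; [|alra..].
by congr (sin _ / _); ring.
Qed.

Let weight4_out (x : R) : x <= a \/ 3 * a <= x -> S x * p4 x = 0.
Proof.
move=> xout; rewrite /sin_weight; case: ifP => [hx|_]; last exact: mul0r.
rewrite sinM_p4// /w4; case: xout => hx'; last first.
  by rewrite !ifF//; apply/negbTE; rewrite -leNgt; alra.
case: (ltP x a) => // hx''; have -> : x = a by alra.
by rewrite ifT; [rewrite subrr sin0 mul0r|alra].
Qed.

Let weight4_low (x : R) : a <= x -> x <= 2 * a ->
  S x * p4 x = sin (x - a) / (2 * cos a).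
Proof.
move=> x1 x2; have x0 : (0 <= x) && (x <= pi) by apply: inside; alra.
rewrite /sin_weight x0 sinM_p4// /w4 ifF; last by apply/negbTE; rewrite -leNgt.
case: (ltP x (2 * a)) => // h; have -> : x = 2 * a by alra.
rewrite ifT; last by alra.
by rewrite -sinN; congr (sin _ / _); ring.
Qed.

Let weight4_high (x : R) : 2 * a <= x -> x <= 3 * a ->
  S x * p4 x = sin (3 * a - x) / (2 * cos a).
Proof.
move=> x1 x2; have x0 : (0 <= x) && (x <= pi) by apply: inside; alra.
rewrite /sin_weight x0 sinM_p4// /w4 ifF; last by apply/negbTE; rewrite -leNgt; alra.
rewrite ifF; last by apply/negbTE; rewrite -leNgt.
rewrite -sinN opprB; case: (ltP x (3 * a)) => // h.
have -> : x = 3 * a by alra.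
by rewrite subrr sin0 mul0r.
Qed.

Lemma detailed_balance44 (x : R) : S x * p4 x = S (T4 x) * p4 (T4 x).
Proof.
rewrite /feres_T4; have [h1|h1] := leP x a.
  by rewrite !weight4_out//; [right|left]; alra.
have [h2|h2] := leP (3 * a) x.
  by rewrite !weight4_out//; [left|right]; alra.
have [h3|h3] := leP x (2 * a).
  rewrite weight4_low//; [|alra..]; rewrite weight4_high; [|alra..].
  by congr (sin _ / _); ring.
rewrite weight4_high//; [|alra..]; rewrite weight4_low; [|alra..].
by congr (sin _ / _); ring.
Qed.

End Weights.

(** * Incommensurable periods *)

Lemma int_ratio_rational (R : realType) (k l : int) :
  rational (k%:~R / l%:~R : R).
Proof.
exists (k%:~R / l%:~R) => //=.
by rewrite fmorph_div /= !ratr_int.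
Qed.

(** Otherwise the positive part [E] of the group Zp + Zq has a positive infimum; it is attained and
    divides both p and q, which makes p / q rational. *)
Lemma small_int_combination (R : realType) (p q : R) :
  0 < p -> irrational (p / q) ->
  forall d : R, 0 < d -> exists m n : int, 0 < m%:~R * p + n%:~R * q < d.
Proof.
move=> p0 irr d d0; apply: contrapT => nex; apply: irr.
pose E : set R := [set e | 0 < e /\ exists m n : int, e = m%:~R * p + n%:~R * q].
have EB x y : E x -> E y -> x < y -> E (y - x).
  move=> [x0 [m [n ->]]] [y0 [m' [n' ->]]] xy; split; first by rewrite subr_gt0.
  by exists (m' - m), (n' - n); rewrite !intrB; ring.
have Ep : E p by split=> //; exists 1, 0; rewrite mul1r mul0r addr0.
have Elb : lbound E d.
  move=> e [e0 [m [n emn]]]; rewrite leNgt; apply/negP => ed; apply: nex.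
  by exists m, n; rewrite -emn e0.
have Einf : has_inf E by split; [exists p|exists d].
set i := inf E.
have di : d <= i by apply: lb_le_inf => //; exists p.
have i0 : 0 < i by apply: lt_le_trans di.
have lei e : E e -> i <= e by move=> Ee; apply: (ge_inf Einf.2).
(* If the infimum were not attained, two distinct elements of [E] in ]i, 2i[ would differ by an
   element of [E] below i. *)
have Ei : E i.
  have [e Ee ei] := inf_adherent i0 Einf.
  have [<-//|ine] := eqVneq e i.
  have ie : i < e by rewrite lt_neqAle eq_sym ine lei.
  have ei0 : 0 < e - i by rewrite subr_gt0.
  have [e' Ee' ei'] := inf_adherent ei0 Einf.
  rewrite addrC subrK in ei'.
  have := lei _ (EB _ _ Ee' Ee ei'); have := lei _ Ee'.
  by rewrite -/i in ei; lra.
(* Division with remainder by i: a nonzero remainder would be an element of [E] below the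
   infimum. *)
have multiple (r : R) : (exists m n : int, r = m%:~R * p + n%:~R * q) ->
    exists k : int, r = k%:~R * i.
  move=> [m [n rmn]]; exists (Num.floor (r / i)).
  have /andP[] := floor_itv (r / i); rewrite intrD.
  set k : R := (Num.floor (r / i))%:~R.
  rewrite ler_pdivlMr// ltr_pdivrMr// mulrDl mul1r => kr rk.
  apply/eqP; rewrite eq_le kr andbT leNgt; apply/negP => krlt.
  have Er : E (r - k * i).
    split; first by rewrite subr_gt0.
    case: Ei => _ [m' [n' imn]].
    exists (m - Num.floor (r / i) * m'), (n - Num.floor (r / i) * n').
    by rewrite !intrB !intrM -/k {1}rmn {1}imn; ring.
  by have := lei _ Er; lra.
have [|k pk] := multiple p; first by exists 1, 0; rewrite mul1r mul0r addr0.
have [|l ql] := multiple q; first by exists 0, 1; rewrite mul1r mul0r add0r.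
rewrite pk ql invfM mulrACA divff ?mulr1; last exact: lt0r_neq0.
exact: int_ratio_rational.
Qed.

Lemma periodicMz (R : realType) (t : R) (L : R -> R) (m : int) :
  periodic L t -> periodic L (m%:~R * t).
Proof.
move=> Lt x; case: m => n; first by rewrite mulr_natl periodicn.
rewrite NegzE mulrNz mulNr mulr_natl.
by rewrite -(periodicn Lt n.+1) subrK.
Qed.

(** There are arbitrarily small periods s, so x can be moved into [0, s[, where the linear bound
    makes L small. The one-sided bound near 0 takes the place of continuity. *)
Lemma biperiodic_eq0 (R : realType) (p q C : R) (L : R -> R) :
  0 < p -> irrational (p / q) -> periodic L p -> periodic L q ->
  (forall r, 0 <= r < p -> `|L r| <= C * r) ->
  forall x, L x = 0.
Proof.
move=> p0 irr Lp Lq LC x.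
have C0 : 0 <= C.
  have := LC (p / 2); rewrite (_ : 0 <= p / 2 < p); last by apply/andP; split; lra.
  move=> /(_ isT)/(le_trans (normr_ge0 _)).
  by rewrite pmulr_lge0// divr_gt0.
apply/eqP; rewrite -normr_eq0 eq_le normr_ge0 andbT.
apply/ler_addgt0Pr => e e0; rewrite add0r.
(* The bound by p keeps the reduced point where the linear estimate applies; the other one makes C s
   at most e, with + 1 because C may be 0. *)
have d0 : 0 < Num.min p (e / (C + 1)).
  by rewrite lt_min p0 divr_gt0// ltr_wpDl.
have [m [n]] := small_int_combination p0 irr d0.
set s := _ + _ => /andP[s0]; rewrite lt_min => /andP[sp].
rewrite ltr_pdivlMr ?ltr_wpDl// => se.
have Ls : periodic L s.
  by move=> y; rewrite /s addrA (periodicMz n Lq) (periodicMz m Lp).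
pose k := Num.floor (x / s); pose r := x - k%:~R * s.
have /andP[] := floor_itv (x / s); rewrite intrD -/k.
rewrite ler_pdivlMr// ltr_pdivrMr// mulrDl mul1r => kr rk.
have -> : L x = L r by rewrite -(subrK (k%:~R * s) x) (periodicMz k Ls).
have r0 : 0 <= r by rewrite subr_ge0.
have rs : r < s by rewrite /r; lra.
apply: (le_trans (LC r _)); first by rewrite r0 (lt_trans rs sp).
by nra.
Qed.

(** For a primitive, a reflection symmetry of the density says that F x + F (6 a - x) is constant,
    which explains the crossed increments. The bound by x gives F 0 = 0 and the linear estimate
    required by [biperiodic_eq0]. *)
Lemma linear_of_local_symmetries (R : realType) (a : R) (F : R -> R) :
  0 < a -> 6 * a < pi -> irrational (a / pi) ->
  (forall x, 0 <= x <= pi -> `|F x| <= x) ->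
  (forall x y, 0 <= x -> x <= y -> y <= pi - 4 * a ->
    F (y + 4 * a) - F (x + 4 * a) = F y - F x) ->
  (forall x y, 3 * a <= x -> x <= y -> y <= 5 * a ->
    F y - F x = F (6 * a - x) - F (6 * a - y)) ->
  (forall x y, pi - 5 * a <= x -> x <= y -> y <= pi - 3 * a ->
    F y - F x = F (2 * pi - 6 * a - x) - F (2 * pi - 6 * a - y)) ->
  exists c, forall x, 0 <= x <= pi -> F x = c * x.
Proof.
move=> a0 api irr Flip FA FB FC.
have F0 : F 0 = 0.
  have := Flip 0; rewrite lexx pi_ge0 => /(_ isT).
  by rewrite normr_le0 => /eqP.
(* The slope for which [L0] agrees at 0 and 4 a, so that the first symmetry becomes genuine
   periodicity. *)
pose c := F (4 * a) / (4 * a).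
have p0 : 0 < 4 * a by lra.
have c4 : c * (4 * a) = F (4 * a) by rewrite divfK// gt_eqF.
pose L0 x := F x - c * x.
have L0A x : 0 <= x -> x <= pi - 4 * a -> L0 (x + 4 * a) = L0 x.
  move=> x0 xpi; have := FA 0 x (lexx _) x0 xpi.
  by rewrite F0 add0r subr0 /L0 mulrDr c4 => <-; ring.
pose k x := Num.floor (x / (4 * a)).
(* Periodic extension of [L0] from [0, 4 a[ to the line; [LL0] shows that it still agrees with [L0]
   on all of [0, pi]. *)
pose L x := L0 (x - (k x)%:~R * (4 * a)).
have kP x : 0 <= x - (k x)%:~R * (4 * a) < 4 * a.
  have /andP[] := floor_itv (x / (4 * a)); rewrite intrD -/(k x).
  by rewrite ler_pdivlMr// ltr_pdivrMr// mulrDl mul1r => ? ?; apply/andP; split; lra.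
have Lper : periodic L (4 * a).
  move=> x; rewrite /L; have -> : k (x + 4 * a) = k x + 1.
    by rewrite /k mulrDl divff ?gt_eqF// floorDrz ?floor1//; exact: rpred1.
  by congr L0; rewrite intrD; ring.
have L_small x : 0 <= x < 4 * a -> L x = L0 x.
  move=> /andP[x0 x4]; rewrite /L (_ : k x = 0) ?mul0r ?subr0//.
  by apply: floor_def; rewrite add0r divr_ge0 ?(ltW p0)//= ltr_pdivrMr// mul1r.
have LL0 x : 0 <= x <= pi -> L x = L0 x.
  move=> /andP[]; have [n] : exists n : nat, x < n%:R * (4 * a).
    exists (Num.trunc (x / (4 * a))).+1.
    by rewrite -ltr_pdivrMr//; exact: truncnS_gt.
  elim: n x => [|n IHn] x; first by rewrite mul0r => ? ?; lra.
  rewrite -natr1 mulrDl mul1r => xn x0 xpi.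
  have [x4|x4] := ltP x (4 * a); first by apply: L_small; rewrite x0.
  rewrite -(subrK (4 * a) x) Lper IHn; [|lra..].
  by rewrite L0A//; lra.
have LB : forall x, L (6 * a - x) = L (3 * a) + L (3 * a) - L x.
  have B1 x : 3 * a <= x -> x <= 5 * a ->
      L (6 * a - x) = L (3 * a) + L (3 * a) - L x.
    move=> x3 x5; rewrite !LL0; [|by apply/andP; split; lra..].
    have := FB _ x (lexx _) x3 x5; rewrite (_ : 6 * a - 3 * a = 3 * a); last by ring.
    by rewrite /L0 => ?; lra.
  (* The reflection about 3 a exchanges [a, 3 a] and [3 a, 5 a], which together form a full period;
     periodicity then reaches every x. *)
  have B2 x : a <= x -> x <= 5 * a ->
      L (6 * a - x) = L (3 * a) + L (3 * a) - L x.
    move=> x1 x5; have [x3|x3] := leP (3 * a) x; first exact: B1.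
    have := B1 (6 * a - x); rewrite (_ : 6 * a - (6 * a - x) = x); last by ring.
    have -> : 3 * a <= 6 * a - x by lra.
    have -> : 6 * a - x <= 5 * a by lra.
    by move=> /(_ isT isT) ->; ring.
  move=> x; pose m := k (x - a).
  have /andP[y0 y4] := kP (x - a); rewrite -/m in y0 y4.
  have := B2 (x - m%:~R * (4 * a)).
  rewrite (_ : a <= _); last by lra.
  rewrite (_ : _ <= 5 * a); last by lra.
  move=> /(_ isT isT).
  have -> : 6 * a - (x - m%:~R * (4 * a)) = 6 * a - x + m%:~R * (4 * a) by ring.
  rewrite (periodicMz m Lper) => ->; congr (_ - _).
  by rewrite -[RHS](periodicMz (- m) Lper) intrN mulNr.
have LC : forall x, L (2 * pi - 6 * a - x) =
    L (pi - 3 * a) + L (pi - 3 * a) - L x.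
  have C1 x : pi - 5 * a <= x -> x <= pi - 3 * a ->
      L (2 * pi - 6 * a - x) = L (pi - 3 * a) + L (pi - 3 * a) - L x.
    move=> x3 x5; rewrite !LL0; [|by apply/andP; split; lra..].
    have := FC x _ x3 x5 (lexx _).
    rewrite (_ : 2 * pi - 6 * a - (pi - 3 * a) = pi - 3 * a); last by ring.
    by rewrite /L0 => ?; lra.
  have C2 x : pi - 5 * a <= x -> x <= pi - a ->
      L (2 * pi - 6 * a - x) = L (pi - 3 * a) + L (pi - 3 * a) - L x.
    move=> x1 x5; have [x3|x3] := leP x (pi - 3 * a); first exact: C1.
    have := C1 (2 * pi - 6 * a - x).
    rewrite (_ : 2 * pi - 6 * a - (2 * pi - 6 * a - x) = x); last by ring.
    have -> : pi - 5 * a <= 2 * pi - 6 * a - x by lra.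
    have -> : 2 * pi - 6 * a - x <= pi - 3 * a by lra.
    by move=> /(_ isT isT) ->; ring.
  move=> x; pose m := k (x - (pi - 5 * a)).
  have /andP[y0 y4] := kP (x - (pi - 5 * a)); rewrite -/m in y0 y4.
  have := C2 (x - m%:~R * (4 * a)).
  rewrite (_ : pi - 5 * a <= _); last by lra.
  rewrite (_ : _ <= pi - a); last by lra.
  move=> /(_ isT isT).
  have -> : 2 * pi - 6 * a - (x - m%:~R * (4 * a)) =
    2 * pi - 6 * a - x + m%:~R * (4 * a) by ring.
  rewrite (periodicMz m Lper) => ->; congr (_ - _).
  by rewrite -[RHS](periodicMz (- m) Lper) intrN mulNr.
pose kappa := L (pi - 3 * a) + L (pi - 3 * a) - (L (3 * a) + L (3 * a)).
(* The two reflections compose to a translation by 2 pi - 3 (4 a). Each one also changes the sign of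
   L, so the signs cancel and a constant remains. *)
have Lpi x : L (x + 2 * pi) = L x + kappa.
  have := LC (6 * a - x); rewrite LB.
  have -> : 2 * pi - 6 * a - (6 * a - x) = x + 2 * pi + (-3)%:~R * (4 * a) by ring.
  by rewrite (periodicMz _ Lper) => ->; rewrite /kappa; ring.
have L0b x : 0 <= x < 4 * a -> `|L0 x| <= (1 + `|c|) * x.
  move=> /andP[x0 x4]; apply: (le_trans (ler_normB _ _)).
  rewrite mulrDl mul1r normrM (ger0_norm x0) lerD2r; apply: Flip.
  by rewrite x0; lra.
have Lb x : `|L x| <= (1 + `|c|) * (4 * a).
  have /andP[y0 y4] := kP x.
  apply: (le_trans (L0b _ (kP x))); apply: ler_wpM2l; last exact: ltW.
  by rewrite addr_ge0.
have Lpin x n : L (x + n%:R * (2 * pi)) = L x + n%:R * kappa.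
  elim: n => [|n IHn]; first by rewrite !mul0r !addr0.
  by rewrite -natr1 (mulrDl n%:R 1 (2 * pi)) (mulrDl n%:R 1 kappa) !mul1r
    (addrA x) Lpi IHn -addrA.
(* L is bounded, so the increment n kappa over n turns cannot grow without bound. *)
have kappa0 : kappa = 0.
  apply/eqP; apply: contrapT => /negP k0.
  have kp : 0 < `|kappa| by rewrite normr_gt0.
  pose B := (1 + `|c|) * (4 * a).
  have := truncnS_gt ((B + B) / `|kappa|); set n := _.+1.
  rewrite ltr_pdivrMr// => Bn.
  have e : n%:R * kappa = L (0 + n%:R * (2 * pi)) - L 0 by rewrite Lpin; ring.
  have : `|n%:R * kappa| <= B + B.
    by rewrite e; apply: (le_trans (ler_normB _ _)); apply: lerD; exact: Lb.
  by rewrite normrM normr_nat leNgt Bn.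
have L2pi : periodic L (2 * pi) by move=> x; rewrite Lpi kappa0 addr0.
have irr' : irrational (4 * a / (2 * pi)).
  move=> [r _ re]; apply: irr; exists (r / 2) => //.
  rewrite fmorph_div /= re ratr_nat.
  have pi0 : (pi : R) != 0 by rewrite gt_eqF// pi_gt0.
  by move: (pi : R) pi0 => p p_neq0; field.
have L_eq0 := @biperiodic_eq0 _ _ _ (1 + `|c|) _ p0 irr' Lper L2pi.
exists c => x xpi; apply/eqP; rewrite -subr_eq0 -/(L0 x) -LL0//.
by rewrite L_eq0// => r r4; rewrite L_small//; exact: L0b.
Qed.

(** * Integration of bounded measurable functions *)

Section BoundedMeasurable.
Context {R : realType}.
Local Notation mu := (@lebesgue_measure R).
Implicit Types (f g : R -> R) (D : set (measurableTypeR R)).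

(** Both conditions are global rather than on [0, pi]: the class must be stable under composition
    with the maps [feres_T1] to [feres_T4], which do not preserve the interval. *)
Definition bounded_measurable f :=
  measurable_fun [set: measurableTypeR R] f /\ exists M, forall x, `|f x| <= M.

Lemma bounded_measurable_cst (c : R) : bounded_measurable (fun _ => c).
Proof. by split; [exact: measurable_cst|exists `|c|]. Qed.

Lemma bounded_measurableD f g : bounded_measurable f -> bounded_measurable g ->
  bounded_measurable (fun x => f x + g x).
Proof.
move=> [mf [M fM]] [mg [N gN]]; split; first exact: measurable_funD.
by exists (M + N) => x; rewrite (le_trans (ler_normD _ _))// lerD.
Qed.

Lemma bounded_measurableM f g : bounded_measurable f -> bounded_measurable g ->
  bounded_measurable (fun x => f x * g x).
Proof.
move=> [mf [M fM]] [mg [N gN]]; split; first exact: measurable_funM.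
by exists (M * N) => x; rewrite normrM ler_pM.
Qed.

Lemma bounded_measurableN f : bounded_measurable f ->
  bounded_measurable (fun x => - f x).
Proof.
move=> [mf [M fM]]; split; first exact: measurableT_comp.
by exists M => x; rewrite normrN.
Qed.

Lemma bounded_measurableB f g : bounded_measurable f -> bounded_measurable g ->
  bounded_measurable (fun x => f x - g x).
Proof.
by move=> mf mg; apply: bounded_measurableD => //; exact: bounded_measurableN.
Qed.

Lemma bounded_measurable_norm f : bounded_measurable f ->
  bounded_measurable (fun x => `|f x|).
Proof.
move=> [mf [M fM]]; split; first exact: measurableT_comp.
by exists M => x; rewrite normr_id.
Qed.

Lemma bounded_measurable_comp f g : bounded_measurable f ->
  measurable_fun [set: measurableTypeR R] g -> bounded_measurable (fun x => f (g x)).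
Proof.
by move=> [mf [M fM]] mg; split; [exact: measurableT_comp|exists M].
Qed.

Lemma bounded_measurable_indic D : measurable D ->
  bounded_measurable (fun x => \1_D x : R).
Proof.
move=> mD; split; first exact: measurable_indic.
by exists 1 => x; rewrite indicE; case: (_ \in _); rewrite ?normr1 ?normr0.
Qed.

Definition finite_measurable D := measurable D /\ (mu D < +oo)%E.

Lemma finite_measurable_itv (a b : R) : finite_measurable `[a, b].
Proof.
split; first exact: measurable_itv.
by rewrite lebesgue_measure_itv /=; case: ifP => _; rewrite ltry.
Qed.

Lemma finite_measurable_sub D E : measurable D -> D `<=` E ->
  finite_measurable E -> finite_measurable D.
Proof.
move=> mD DE [mE fE]; split=> //; apply: le_lt_trans fE.
by apply: le_measure => //; rewrite inE.
Qed.

Lemma bounded_measurable_bounded D f : bounded_measurable f ->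
  [bounded f x | x in D].
Proof.
move=> [_ [M fM]]; exists M; split; first exact: num_real.
by move=> y My x _; apply: le_trans (fM x) (ltW My).
Qed.

Lemma bounded_measurable_integrable D f : finite_measurable D ->
  bounded_measurable f -> mu.-integrable D (EFin \o f).
Proof.
move=> [mD fD] bf; apply: measurable_bounded_integrable => //.
  by apply: measurable_funTS; case: bf.
exact: bounded_measurable_bounded.
Qed.

Lemma integrable_mul_bounded D f g : measurable D ->
  mu.-integrable D (EFin \o f) -> bounded_measurable g ->
  mu.-integrable D (EFin \o (fun x => f x * g x)).
Proof.
move=> mD iF bg; have := @integrableMl _ _ _ mu D mD _ g iF.
rewrite (_ : (_ \* _)%E = EFin \o (fun x => f x * g x)); last first.
  by apply/funext => x /=; rewrite EFinM.
apply; first by apply: measurable_funTS; case: bg.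
exact: bounded_measurable_bounded.
Qed.

Lemma integrable_EFinZl D f (c : R) : measurable D ->
  mu.-integrable D (EFin \o f) ->
  mu.-integrable D (EFin \o (fun x => c * f x)).
Proof.
move=> mD iF; rewrite (_ : EFin \o _ = (fun x => c%:E * (EFin \o f) x)%E).
  exact: integrableZl.
by apply/funext => x /=; rewrite EFinM.
Qed.

Lemma integrable_EFinD D f g : measurable D ->
  mu.-integrable D (EFin \o f) -> mu.-integrable D (EFin \o g) ->
  mu.-integrable D (EFin \o (fun x => f x + g x)).
Proof.
move=> mD iF ig.
rewrite (_ : EFin \o _ = (fun x => (EFin \o f) x + (EFin \o g) x)%E).
  exact: integrableD.
by apply/funext => x /=; rewrite EFinD.
Qed.

Lemma integrable_EFinB D f g : measurable D ->
  mu.-integrable D (EFin \o f) -> mu.-integrable D (EFin \o g) ->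
  mu.-integrable D (EFin \o (fun x => f x - g x)).
Proof.
move=> mD iF ig.
rewrite (_ : EFin \o _ = (fun x => (EFin \o f) x - (EFin \o g) x)%E).
  exact: integrableB.
by apply/funext => x /=; rewrite EFinB.
Qed.

Lemma Rintegral_norm_le D f (M : R) : finite_measurable D ->
  bounded_measurable f -> (forall x, D x -> `|f x| <= M) ->
  `|\int[mu]_(x in D) f x| <= M * fine (mu D).
Proof.
move=> fD bf fM; have [mD _] := fD.
have intf := bounded_measurable_integrable fD bf.
apply: (le_trans (le_normr_Rintegral mD intf)).
rewrite -Rintegral_cst//; apply: le_Rintegral => //.
- exact: bounded_measurable_integrable (bounded_measurable_norm bf).
- exact: bounded_measurable_integrable (bounded_measurable_cst _).
Qed.

End BoundedMeasurable.

(** * Translation and reflection invariance of Lebesgue integrals *)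

Section ChangeOfVariables.
Context {R : realType}.
Local Notation mu := (@lebesgue_measure R).

Let shift_measurable (c : R) :
  measurable_fun [set: measurableTypeR R] (fun x : measurableTypeR R => x + c : measurableTypeR R).
Proof. exact: measurable_funD. Qed.

Let reflect_measurable (c : R) :
  measurable_fun [set: measurableTypeR R] (fun x : measurableTypeR R => c - x : measurableTypeR R).
Proof. exact: measurable_funB. Qed.

(** The pushforward formula is applied to the positive and negative parts separately, and the image
    measure is then replaced by [mu]. *)
Let Rintegral_pushforward (phi : measurableTypeR R -> measurableTypeR R)
    (mphi : measurable_fun [set: measurableTypeR R] phi) (f : R -> R) :
  (forall A, measurable A -> pushforward mu phi A = mu A) ->
  measurable_fun [set: measurableTypeR R] f ->
  \int[mu]_x f (phi x) = \int[mu]_x f x.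
Proof.
move=> inv mf; rewrite /Rintegral; congr fine.
pose mixin := isMeasurableFun.Build _ _ _ _ phi mphi.
pose pack : {mfun measurableTypeR R >-> measurableTypeR R} := HB.pack phi mixin.
have key (g : R -> \bar R) : measurable_fun [set: measurableTypeR R] g -> (forall y, 0 <= g y)%E ->
    (\int[mu]_x g (phi x) = \int[mu]_x g x)%E.
  move=> mg g0.
  have := ge0_integral_pushforward mphi mu (measurableT) mg (fun y _ => g0 y).
  rewrite preimage_setT => <-.
  by apply: (@eq_measure_integral _ _ _ _ mu (pushforward mu pack)) => A mA _; exact: inv.
have mEf : measurable_fun [set: measurableTypeR R] (EFin \o f) by exact/measurable_EFinP.
rewrite integralE [RHS]integralE; congr (_ - _)%E.
  rewrite -(key (EFin \o f)^\+%E); [|exact: measurable_funepos|by []].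
  by apply: eq_integral => x _; rewrite !funeposE.
rewrite -(key (EFin \o f)^\-%E); [|exact: measurable_funeneg|by []].
by apply: eq_integral => x _; rewrite !funenegE.
Qed.

Lemma Rintegral_shift (f : R -> R) (c : R) : measurable_fun [set: measurableTypeR R] f ->
  \int[mu]_x f (x + c) = \int[mu]_x f x.
Proof.
apply: (Rintegral_pushforward (shift_measurable c)) => A mA.
pose mixin := isMeasurableFun.Build _ _ _ _ _ (shift_measurable c).
pose pack : {mfun measurableTypeR R >-> measurableTypeR R} := HB.pack (fun x : measurableTypeR R => x + c : measurableTypeR R) mixin.
apply/esym/(@lebesgue_measure_unique R (pushforward mu pack)) => // _ [[a b] _ <-] /=.
rewrite /pushforward (_ : _ @^-1` _ = `]a - c, b - c]%classic).
  rewrite !lebesgue_measure_itv/= !lte_fin ltrBlDr subrK.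
  by case: ifP => // _; rewrite -!EFinB; congr EFin; ring.
by apply/seteqP; split => x /=; rewrite !in_itv/= => /andP[? ?]; apply/andP; split; lra.
Qed.

Lemma Rintegral_reflect (f : R -> R) (c : R) : measurable_fun [set: measurableTypeR R] f ->
  \int[mu]_x f (c - x) = \int[mu]_x f x.
Proof.
apply: (Rintegral_pushforward (reflect_measurable c)) => A mA.
pose mixin := isMeasurableFun.Build _ _ _ _ _ (reflect_measurable c).
pose pack : {mfun measurableTypeR R >-> measurableTypeR R} := HB.pack (fun x : measurableTypeR R => c - x : measurableTypeR R) mixin.
apply/esym/(@lebesgue_measure_unique R (pushforward mu pack)) => // _ [[a b] _ <-] /=.
(* Reflection moves the open end to the right, but the length is unchanged, which is all that
   uniqueness of Lebesgue measure asks for. *)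
rewrite /pushforward (_ : _ @^-1` _ = `[c - b, c - a[%classic).
  rewrite !lebesgue_measure_itv/= !lte_fin ltrD2l ltrN2.
  by case: ifP => // _; rewrite -!EFinB; congr EFin; ring.
by apply/seteqP; split => x /=; rewrite !in_itv/= => /andP[? ?]; apply/andP; split; lra.
Qed.

Lemma Rintegral_itv_shift (f : R -> R) (a b c : R) : measurable_fun [set: measurableTypeR R] f ->
  \int[mu]_(x in `[a, b]) f (x + c) = \int[mu]_(x in `[a + c, b + c]) f x.
Proof.
move=> mf; rewrite Rintegral_mkcond [RHS]Rintegral_mkcond -[RHS](Rintegral_shift c).
  apply: eq_Rintegral => x _; rewrite /patch.
  by rewrite !mem_setE !in_itv/= !lerD2r.
apply/measurable_restrict; [exact: measurable_itv|by []|].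
exact: measurable_funTS.
Qed.

Lemma Rintegral_itv_reflect (f : R -> R) (a b c : R) : measurable_fun [set: measurableTypeR R] f ->
  \int[mu]_(x in `[a, b]) f (c - x) = \int[mu]_(x in `[c - b, c - a]) f x.
Proof.
move=> mf; rewrite Rintegral_mkcond [RHS]Rintegral_mkcond -[RHS](Rintegral_reflect c).
  apply: eq_Rintegral => x _; rewrite /patch.
  by rewrite !mem_setE !in_itv/= !lerD2l !lerN2 andbC.
apply/measurable_restrict; [exact: measurable_itv|by []|].
exact: measurable_funTS.
Qed.

End ChangeOfVariables.

(** * From small weighted squares to small weighted means *)

Section WeightedSquare.
Context {R : realType}.
Local Notation mu := (@lebesgue_measure R).

(** The threshold d does not depend on u, only on its bound M. With v = 1 this exchanges a
    degenerate weight for Lebesgue measure; with v the modulus of a density it reaches the law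
    [nu]. *)
Lemma small_of_weighted_square (D : set (measurableTypeR R)) (phi v : R -> R) (M : R) :
  measurable D -> measurable_fun [set: measurableTypeR R] phi -> measurable_fun [set: measurableTypeR R] v ->
  (forall x, D x -> 0 < phi x) -> (forall x, D x -> 0 <= v x) ->
  mu.-integrable D (EFin \o phi) ->
  mu.-integrable D (EFin \o v) ->
  forall e : R, 0 < e -> exists2 d : R, 0 < d &
    forall u : R -> R, measurable_fun [set: measurableTypeR R] u -> (forall x, `|u x| <= M) ->
      \int[mu]_(x in D) (phi x * u x ^+ 2) < d ->
      \int[mu]_(x in D) (v x * `|u x|) < e.
Proof.
move=> mD mphi mv phi0 v0 iphi iv e e0.
(* Split v = w k + min(v, k phi): the first part is small in L^1 for large k,
   and on the second |u| <= eta + u^2 / eta. *)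
pose w (k : nat) x := v x - Num.min (v x) (k%:R * phi x).
have mw k : measurable_fun [set: measurableTypeR R] (w k).
  apply: measurable_funB => //; apply: measurable_minr => //.
  exact: measurable_funM.
have w0 k x : D x -> 0 <= w k x.
  by move=> Dx; rewrite subr_ge0 ge_min lexx.
have wv k x : D x -> w k x <= v x.
  move=> Dx; rewrite gerBl le_min v0//= mulr_ge0//; exact/ltW/phi0.
have iw k : mu.-integrable D (EFin \o w k).
  apply: (@le_integrable _ _ _ mu D mD _ (EFin \o v)) => //.
  - by apply/measurable_EFinP; exact: measurable_funTS.
  - by move=> x Dx /=; rewrite lee_fin !ger0_norm ?wv ?w0 ?v0.
have wcvg x : D x -> (EFin \o w k) x @[k --> \oo] --> 0%E.
  move=> Dx; apply: cvg_near_cst.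
  near=> k; rewrite /= /w; congr EFin; apply/eqP; rewrite subr_eq0 eq_sym.
  apply/eqP/min_idPl; rewrite -ler_pdivrMr ?phi0//.
  by near: k; exact: nbhs_infty_ger.
have absw : {ae mu, forall x k, D x -> `|(EFin \o w k) x| <= (EFin \o v) x}%E.
  by apply: aeW => x k Dx; rewrite /= lee_fin ger0_norm ?wv ?w0.
have mEw k : measurable_fun D (EFin \o w k).
  by apply/measurable_EFinP; exact: measurable_funTS.
have [_ _] := dominated_convergence mD mEw
  (measurable_cst 0%E) (aeW _ wcvg) iv absw.
rewrite integral_cst// mul0e => /fine_cvgP[_].
rewrite -/(Rintegral _ _ _) => wlim.
pose Phi := \int[mu]_(x in D) phi x.
have Phi0 : 0 <= Phi by apply: Rintegral_ge0 => x /phi0/ltW.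
have M1 : 0 < `|M| + 1 by rewrite ltr_wpDl.
have e1 : 0 < e / (3 * (`|M| + 1)) by rewrite divr_gt0// mulr_gt0.
have /cvgrPdist_lt/(_ _ e1)[k _ /(_ k (leqnn k))] := wlim.
rewrite sub0r normrN /= -/(Rintegral _ _ _) => wk.
pose K : R := k.+1%:R.
have K0 : 0 < K by rewrite ltr0n.
(* Three errors of e / 3 each: the part [w k], the term K eta Phi controlled by this choice, and K /
   eta times the weighted square, controlled by the threshold chosen below. *)
pose eta := e / (3 * K * (Phi + 1)).
have P1 : 0 < Phi + 1 by rewrite ltr_wpDl.
have eta0 : 0 < eta by apply: divr_gt0 => //; apply: mulr_gt0 => //; exact: mulr_gt0.
exists (e * eta / (3 * K)); first by apply: divr_gt0; exact: mulr_gt0.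
move=> u mu' uM small.
have bu : bounded_measurable u by split=> //; exists M.
have bu2 : bounded_measurable (fun x => u x ^+ 2).
  by under eq_fun do rewrite expr2; exact: bounded_measurableM.
have iphiu : mu.-integrable D (EFin \o (fun x => phi x * u x ^+ 2)).
  exact: integrable_mul_bounded.
have ivu : mu.-integrable D (EFin \o (fun x => v x * `|u x|)).
  by apply: integrable_mul_bounded => //; exact: bounded_measurable_norm.
pose g x := (`|M| + 1) * w k x + (K * eta * phi x + K / eta * (phi x * u x ^+ 2)).
have igw : mu.-integrable D (EFin \o (fun x => (`|M| + 1) * w k x)).
  exact: integrable_EFinZl.
have ig1 : mu.-integrable D (EFin \o (fun x => K * eta * phi x)).
  exact: integrable_EFinZl.
have ig2 : mu.-integrable D (EFin \o (fun x => K / eta * (phi x * u x ^+ 2))).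
  exact: integrable_EFinZl.
have ig12 : mu.-integrable D
    (EFin \o (fun x => K * eta * phi x + K / eta * (phi x * u x ^+ 2))).
  exact: integrable_EFinD.
have ig : mu.-integrable D (EFin \o g) by exact: integrable_EFinD.
have le_g x : D x -> v x * `|u x| <= g x.
  move=> Dx; have := phi0 _ Dx; have := w0 k _ Dx; have := uM x.
  have : v x <= w k x + K * phi x.
    rewrite /w -lerBlDl opprB addrCA subrr addr0 ge_min.
    by rewrite ler_wpM2r ?orbT// ?ler_nat//; exact/ltW/phi0.
  rewrite /g; have -> : u x ^+ 2 = `|u x| ^+ 2 by rewrite real_normK// num_real.
  move: (w k x) (phi x) (v x) (normr_ge0 (u x)).
  move: `|u x| (ler_norm M) => U MM W p V U0 VW UM W0 p0.
  have UU : U <= eta + U ^+ 2 / eta.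
    rewrite -(@ler_pM2r _ eta)// mulrDl divfK ?gt_eqF//.
    by have := sqr_ge0 (U - eta); have := sqr_ge0 U; have := sqr_ge0 eta; nra.
  have U1 : U <= `|M| + 1 by lra.
  have h1 : V * U <= (W + K * p) * U by rewrite ler_wpM2r.
  have h2 : W * U <= W * (`|M| + 1) by rewrite ler_wpM2l.
  have h3 : K * p * U <= K * p * (eta + U ^+ 2 / eta).
    by rewrite ler_wpM2l// ltW// mulr_gt0.
  have -> : (`|M| + 1) * W + (K * eta * p + K / eta * (p * U ^+ 2)) =
      W * (`|M| + 1) + K * p * (eta + U ^+ 2 / eta).
    by field; rewrite gt_eqF.
  by lra.
apply: (le_lt_trans (le_Rintegral mD ivu ig le_g)).
rewrite RintegralD// RintegralD// !RintegralZl// -/Phi.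
have h1 : (`|M| + 1) * \int[mu]_(x in D) w k x < e / 3.
  rewrite -ltr_pdivlMl// mulrC -mulrA -invfM.
  exact: (le_lt_trans (ler_norm _)).
have h2 : K * eta * Phi <= e / 3.
  rewrite /eta; have -> : K * (e / (3 * K * (Phi + 1))) * Phi = e / 3 * (Phi / (Phi + 1)).
    by field; rewrite !gt_eqF.
  rewrite ler_piMr ?divr_ge0 ?(ltW e0)//.
  by rewrite ler_pdivrMr// mul1r lerDl.
have h3 : K / eta * \int[mu]_(x in D) (phi x * u x ^+ 2) < e / 3.
  have Ke : 0 < K / eta by apply: divr_gt0.
  rewrite -ltr_pdivlMl// (_ : (K / eta)^-1 * (e / 3) = e * eta / (3 * K))//.
  by field; rewrite !gt_eqF.
by lra.
Unshelve. all: by end_near.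
Qed.

End WeightedSquare.

(** * Weak convergence to zero *)

Import HBSimple.

Section WeakNull.
Context {R : realType}.
Local Notation mu := (@lebesgue_measure R).
Variables (L M : R) (g : nat -> R -> R).
Local Notation E := (`[0, L]%classic : set (measurableTypeR R)).
Hypothesis mg : forall n, measurable_fun [set: measurableTypeR R] (g n).
Hypothesis gM : forall n x, `|g n x| <= M.
Hypothesis g_itv : forall a b, 0 <= a -> a <= b -> b <= L ->
  (\int[mu]_(x in `[a, b]) g n x) @[n --> \oo] --> (0 : R).

Let bg n : bounded_measurable (g n). Proof. by split=> //; exists M. Qed.

Let fE : finite_measurable E. Proof. exact: finite_measurable_itv. Qed.

Let mE : measurable E. Proof. by case: fE. Qed.

Let fS (S : set (measurableTypeR R)) : measurable S -> finite_measurable (S `&` E).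
Proof.
move=> mS; apply: (finite_measurable_sub _ _ fE).
  exact: measurableI.
exact: subIsetr.
Qed.

Let intg n (S : set (measurableTypeR R)) : measurable S -> mu.-integrable (S `&` E) (EFin \o g n).
Proof. by move=> mS; apply: bounded_measurable_integrable => //; exact: fS. Qed.

(** These sets form a Dynkin system containing the half-open intervals. Intersecting with [E] keeps
    complements inside a set of finite measure. *)
Let good (S : set (measurableTypeR R)) :=
  (\int[mu]_(x in S `&` E) g n x) @[n --> \oo] --> (0 : R).

Let good0 : good set0.
Proof.
rewrite /good set0I; apply: cvg_near_cst; apply: nearW => n.
exact: Rintegral_set0.
Qed.

Let goodT : good [set: measurableTypeR R].
Proof.
rewrite /good setTI.
have [L0|L0] := leP 0 L; first by apply: g_itv.
apply: cvg_near_cst; apply: nearW => n.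
by rewrite set_itv_ge ?Rintegral_set0// bnd_simp -ltNge.
Qed.

(** Meeting with [0, L] leaves at most one point or, up to a left end point of measure zero, the
    closed interval [max a 0, min b L]. *)
Let good_ocitv (S : set (measurableTypeR R)) : ocitv S -> good S.
Proof.
move=> [[a b] _ <-] /=.
have [ba|ab] := leP (Num.min b L) (Num.max a 0).
  have cst n : \int[mu]_(x in `]a, b] `&` E) g n x = 0.
    have [S0|S1] := eqVneq (Num.min b L) (Num.max a 0); last first.
      rewrite (_ : _ `&` _ = set0) ?Rintegral_set0//.
      rewrite -subset0 => x [] /=; rewrite !in_itv/= => /andP[ax xb] /andP[x0 xL].
      have : Num.max a 0 <= Num.min b L.
        by rewrite ge_max !le_min; apply/andP; split; apply/andP; split; lra.
      by move=> ?; move: S1; rewrite eq_le ba => /negP; apply.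
    have sub : `]a, b] `&` E `<=` [set Num.max a 0].
      move=> x [] /=; rewrite !in_itv/= => /andP[ax xb] /andP[x0 xL].
      apply/eqP; rewrite eq_le ge_max (ltW ax) x0 andbT.
      by rewrite -S0 le_min xb xL.
    have [->|->] := subset_set1 sub; first exact: Rintegral_set0.
    exact: Rintegral_set1.
  by rewrite /good; under eq_fun do rewrite cst; exact: cvg_cst.
pose a' := Num.max a 0; pose b' := Num.min b L.
have cst n : \int[mu]_(x in `]a, b] `&` E) g n x = \int[mu]_(x in `[a', b']) g n x.
  have [a0|a0] := ltP a 0.
    have -> : a' = 0 by apply/max_idPr/ltW.
    congr (Rintegral mu _ _); apply/seteqP; split => x /=; rewrite !in_itv/= le_min.
      by move=> [/andP[ax ->] /andP[-> ->]].
    by move=> /andP[x0 /andP[-> ->]]; rewrite x0 (lt_le_trans a0).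
  have -> : a' = a by apply/max_idPl.
  rewrite -Rintegral_itv_obnd_cbnd.
    congr (Rintegral mu _ _); apply/seteqP; split => x /=; rewrite !in_itv/= le_min.
      by move=> [/andP[-> ->] /andP[_ ->]].
    by move=> /andP[ax /andP[-> ->]]; rewrite ax (le_trans a0 (ltW ax)).
  apply: bounded_measurable_integrable => //.
  apply: (finite_measurable_sub _ _ (finite_measurable_itv a b')).
    exact: measurable_itv.
  by move=> x /=; rewrite !in_itv/= => /andP[/ltW-> ->].
rewrite /good; under eq_fun do rewrite cst.
apply: g_itv; [by rewrite le_max lexx orbT|exact: ltW|by rewrite ge_min lexx orbT].
Qed.

Let good_setU (A B : set (measurableTypeR R)) : measurable A -> measurable B ->
  A `&` B = set0 -> good A -> good B -> good (A `|` B).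
Proof.
move=> mA mB AB gA gB; rewrite /good.
have e n : \int[mu]_(x in (A `|` B) `&` E) g n x =
    \int[mu]_(x in A `&` E) g n x + \int[mu]_(x in B `&` E) g n x.
  rewrite setIUl Rintegral_setU//; try exact: measurableI.
    by rewrite -setIUl; apply: intg; exact: measurableU.
  by apply/disj_set2P; rewrite setIACA AB set0I.
under eq_fun do rewrite e.
by have := cvgD gA gB; rewrite addr0; exact.
Qed.

Let good_setC (S : set (measurableTypeR R)) : measurable S -> good S -> good (~` S).
Proof.
move=> mS gS; rewrite /good.
have e n : \int[mu]_(x in ~` S `&` E) g n x =
    \int[mu]_(x in [set: measurableTypeR R] `&` E) g n x - \int[mu]_(x in S `&` E) g n x.
  have -> : [set: measurableTypeR R] `&` E = (~` S `&` E) `|` (S `&` E).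
    by rewrite -setIUl setUC setUv.
  rewrite Rintegral_setU ?addrK//.
  - by apply: measurableI => //; exact: measurableC.
  - exact: measurableI.
  - by rewrite -setIUl; apply: intg; apply: measurableU => //; exact: measurableC.
  - by apply/disj_set2P; rewrite setIACA setICl set0I.
under eq_fun do rewrite e.
by have := cvgB goodT gS; rewrite subr0; exact.
Qed.

Let good_finite (F : nat -> set (measurableTypeR R)) K :
  (forall n, measurable (F n)) -> trivIset setT F -> (forall n, good (F n)) ->
  good (\big[setU/set0]_(k < K) F k).
Proof.
move=> mF tF gF; elim: K => [|K IHK]; first by rewrite big_ord0; exact: good0.
rewrite big_ord_recr /=; apply: good_setU => //.
  exact: bigsetU_measurable.
rewrite big_distrl/= big1// => k _.
by move/trivIsetP : tF => /(_ k K Logic.I Logic.I); apply; rewrite neq_ltn ltn_ord.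
Qed.

(** The bound M makes the contribution of the tail [B K] small uniformly in n, so the union can be
    truncated before n grows. *)
Let good_bigcup (F : nat -> set (measurableTypeR R)) :
  (forall n, measurable (F n)) -> trivIset setT F -> (forall n, good (F n)) ->
  good (\bigcup_k F k).
Proof.
move=> mF tF gF.
pose U := \bigcup_k F k; pose UK K := \big[setU/set0]_(k < K) F k.
pose B K := (U `\` UK K) `&` E.
have mU : measurable U by exact: bigcupT_measurable.
have mUK K : measurable (UK K) by exact: bigsetU_measurable.
have mB K : measurable (B K) by apply: measurableI => //; exact: measurableD.
have B0 : \bigcap_K B K = set0.
  rewrite -subset0 => x Bx; have [[[k _ Fkx] _] _] := Bx 0%N Logic.I.
  have [[_ +] _] := Bx k.+1 Logic.I; apply.
  by rewrite /UK big_ord_recr /=; right.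
have muB : mu (B n) @[n --> \oo] --> 0%E.
  rewrite -(measure0 mu) -B0; apply: nonincreasing_cvg_mu => //.
  - by case: (@finite_measurable_sub _ (B 0%N) E (mB 0%N) (@subIsetr _ _ _) fE).
  - exact: bigcap_measurable.
  - move=> m n mn; apply/subsetPset; apply: setSI; apply: setDS.
    exact: subset_bigsetU.
have M0 : 0 <= M by apply: le_trans (gM 0%N 0).
have M1 : 0 < M + 1 by rewrite ltr_wpDl.
apply/cvgrPdist_lt => e e0.
have e1 : 0 < e / 2 / (M + 1) by rewrite !divr_gt0.
have /fine_cvgP[_ /cvgrPdist_lt/(_ _ e1)[K _ /(_ K (leqnn K))]] := muB.
rewrite /= sub0r normrN => BK.
have e2 : 0 < e / 2 by rewrite divr_gt0.
have /cvgrPdist_lt/(_ _ e2)[N _ HN] := good_finite K mF tF gF.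
exists N => // n /HN; rewrite /= !sub0r !normrN => fin.
have UE : U `&` E = (UK K `&` E) `|` B K.
  rewrite /B -setIUl setDUK// => x.
  rewrite /UK; exact: bigsetU_bigcup.
rewrite UE Rintegral_setU; last 4 first.
- exact: measurableI.
- exact: mB.
- by rewrite -UE; exact: intg.
- by apply/disj_set2P; rewrite /B setIACA setIDA (setIC (UK K)) -setIDA setDv setI0 set0I.
have fB : finite_measurable (B K).
  by apply: (finite_measurable_sub (mB K) _ fE); exact: subIsetr.
have hB : `|\int[mu]_(x in B K) g n x| < e / 2.
  apply: (le_lt_trans (Rintegral_norm_le fB (bg n) (fun x _ => gM n x))).
  have h : fine (mu (B K)) < e / 2 / (M + 1) by apply: le_lt_trans BK; exact: ler_norm.
  have h0 : 0 <= fine (mu (B K)) by exact: fine_ge0.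
  move: h; rewrite ltr_pdivlMr// mulrDr mulr1 mulrC => h.
  by apply: le_lt_trans h; rewrite lerDl.
apply: (le_lt_trans (ler_normD _ _)).
by rewrite (splitr e) ltrD.
Qed.

Let good_measurable (S : set (measurableTypeR R)) : measurable S -> good S.
Proof.
have h := @dynkin_induction _ (measurableTypeR R) (@ocitv R) good.
by apply: h => //; exact: ocitvI.
Qed.

Lemma weak_null_indic (S : set (measurableTypeR R)) : measurable S ->
  (\int[mu]_(x in E) (\1_S x * g n x)) @[n --> \oo] --> (0 : R).
Proof.
move=> mS; have := good_measurable mS; rewrite /good.
rewrite (_ : (fun n => _) = (fun n => \int[mu]_(x in E) (\1_S x * g n x)))//.
apply/funext => n; rewrite setIC Rintegral_mkcondr.
by apply: eq_Rintegral => x _; rewrite /patch indicE; case: ifP; rewrite ?mul1r ?mul0r.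
Qed.

Let bsum (s : seq R) (A : R -> set (measurableTypeR R)) :
  (forall r, measurable (A r)) ->
  bounded_measurable (fun x => \sum_(r <- s) r * \1_(A r) x).
Proof.
move=> mA; elim: s => [|r s IHs].
  by under eq_fun do rewrite big_nil; exact: bounded_measurable_cst.
under eq_fun do rewrite big_cons; apply: bounded_measurableD => //.
apply: bounded_measurableM; first exact: bounded_measurable_cst.
exact: bounded_measurable_indic.
Qed.

Lemma weak_null_sum (s : seq R) (A : R -> set (measurableTypeR R)) :
  (forall r, measurable (A r)) ->
  (\int[mu]_(x in E) ((\sum_(r <- s) r * \1_(A r) x) * g n x)) @[n --> \oo] --> (0 : R).
Proof.
move=> mA; elim: s => [|r s IHs].
  apply: cvg_near_cst; apply: nearW => n.
  under eq_Rintegral do rewrite big_nil mul0r.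
  by rewrite Rintegral_cst// mul0r.
have e n : \int[mu]_(x in E) ((\sum_(r <- r :: s) r * \1_(A r) x) * g n x) =
    r * \int[mu]_(x in E) (\1_(A r) x * g n x) +
    \int[mu]_(x in E) ((\sum_(r <- s) r * \1_(A r) x) * g n x).
  have b1 : bounded_measurable (fun x => \1_(A r) x * g n x).
    by apply: bounded_measurableM => //; exact: bounded_measurable_indic.
  have b2 : bounded_measurable (fun x => (\sum_(r <- s) r * \1_(A r) x) * g n x).
    by apply: bounded_measurableM => //; exact: bsum.
  rewrite -RintegralZl//; last exact: bounded_measurable_integrable.
  rewrite -RintegralD//.
  - by apply: eq_Rintegral => x _; rewrite big_cons mulrDl mulrA.
  - apply: integrable_EFinZl => //; exact: bounded_measurable_integrable.
  - exact: bounded_measurable_integrable.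
under eq_fun do rewrite e.
have h : r * \int[mu]_(x in E) (\1_(A r) x * g n x) @[n --> \oo] --> r * 0.
  by apply: cvgMl_tmp; exact: weak_null_indic.
by have := cvgD h IHs; rewrite mulr0 addr0; exact.
Qed.

(** Simple functions are dense in L^1 and the sequence is uniformly bounded, so the error of
    replacing v by a simple function is uniform in n. *)
Lemma weak_null_integrable (v : R -> R) :
  mu.-integrable E (EFin \o v) ->
  (\int[mu]_(x in E) (v x * g n x)) @[n --> \oo] --> (0 : R).
Proof.
move=> iv.
have [s [is_ _ scvg]] := approximation_sfun_integrable mE iv.
have M0 : 0 <= M by apply: le_trans (gM 0%N 0).
have M1 : 0 < M + 1 by rewrite ltr_wpDl.
apply/cvgrPdist_lt => e e0.
have e1 : 0 < e / 2 / (M + 1) by rewrite !divr_gt0.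
have e2 : 0 < e / 2 by rewrite divr_gt0.
have /fine_cvgP[_ /cvgrPdist_lt/(_ _ e1)[k _ /(_ k (leqnn k))]] := scvg.
rewrite /= sub0r normrN => sk.
pose r_ : seq R := finmap.enum_fset (fset_set (range (s k))).
pose A (r : R) : set (measurableTypeR R) := s k @^-1` [set r].
have mA r : measurable (A r) by exact: measurable_funPTI.
have sE x : s k x = \sum_(r <- r_) r * \1_(A r) x.
  by rewrite {1}fimfunE fsbig_finite.
have /cvgrPdist_lt/(_ _ e2)[N _ HN] := weak_null_sum r_ mA.
exists N => // n /HN; rewrite /= !sub0r !normrN => fin.
have bs : bounded_measurable (fun x => \sum_(r <- r_) r * \1_(A r) x) by exact: bsum.
have ibs := bounded_measurable_integrable fE bs.
pose w x := v x - \sum_(r <- r_) r * \1_(A r) x.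
have iw : mu.-integrable E (EFin \o w) by exact: integrable_EFinB.
have iwg := integrable_mul_bounded mE iw (bg n).
have isg := integrable_mul_bounded mE ibs (bg n).
have -> : \int[mu]_(x in E) (v x * g n x) =
    \int[mu]_(x in E) (w x * g n x) +
    \int[mu]_(x in E) ((\sum_(r <- r_) r * \1_(A r) x) * g n x).
  rewrite -RintegralD//; apply: eq_Rintegral => x _.
  by rewrite -mulrDl /w subrK.
have hw : `|\int[mu]_(x in E) (w x * g n x)| < e / 2.
  apply: (le_lt_trans (le_normr_Rintegral mE iwg)).
  have inw : mu.-integrable E (EFin \o (fun x => `|w x|)) by exact: integrable_norm.
  have inM : mu.-integrable E (EFin \o (fun x => M * `|w x|)).
    exact: integrable_EFinZl.
  apply: (@le_lt_trans _ _ (\int[mu]_(x in E) (M * `|w x|))).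
    apply: le_Rintegral => //; first exact: integrable_norm.
    by move=> x _; rewrite normrM mulrC ler_wpM2r.
  rewrite RintegralZl//.
  have h : \int[mu]_(x in E) `|w x| < e / 2 / (M + 1).
    apply: le_lt_trans sk; apply: le_trans (ler_norm _).
    rewrite /Rintegral le_eqVlt; apply/orP; left; apply/eqP; congr fine.
    by apply: eq_integral => x _; rewrite /w -sE.
  have h0 : 0 <= \int[mu]_(x in E) `|w x| by exact: Rintegral_ge0.
  move: h; rewrite ltr_pdivlMr// mulrDr mulr1 mulrC => h.
  by apply: le_lt_trans h; rewrite lerDl.
apply: (le_lt_trans (ler_normD _ _)).
by rewrite (splitr e) ltrD.
Qed.

End WeakNull.

(** * The transition operator *)

Section FeresOperator.
Context {R : realType}.
Local Notation mu := (@lebesgue_measure R).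
Local Notation TR := (measurableTypeR R).

(** Inversion is continuous off 0, and the point 0 is handled as a separate measurable piece. *)
Lemma measurable_invr : measurable_fun [set: TR] (fun x : TR => x^-1 : R).
Proof.
have m0 : measurable ([set 0] : set TR) by exact: measurable_set1.
rewrite (_ : [set: TR] = ~` [set 0] `|` [set 0]); last by rewrite setUC setUv.
apply/measurable_funU => //; first exact: measurableC.
split; last exact: measurable_fun_set1.
apply: subspace_continuous_measurable_fun; first exact: measurableC.
apply: continuous_in_subspaceT => x; rewrite inE /= => /eqP x0.
exact: inv_continuous.
Qed.

Lemma measurable_sin : measurable_fun [set: TR] (fun x : TR => sin x : R).
Proof. by apply: continuous_measurable_fun; exact: continuous_sin. Qed.

Lemma measurable_cos : measurable_fun [set: TR] (fun x : TR => cos x : R).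
Proof. by apply: continuous_measurable_fun; exact: continuous_cos. Qed.

Lemma bounded_measurable_sin : bounded_measurable (fun x : R => sin x).
Proof.
split; first exact: measurable_sin.
by exists 1 => x; rewrite ler_norml sin_geN1 sin_le1.
Qed.

Let measurable_feres_u (b : R) : measurable_fun [set: TR] (feres_u b : TR -> R).
Proof.
rewrite /feres_u; apply: measurable_funM => //; apply: measurable_funD => //.
under eq_fun do rewrite invf_div.
apply: measurable_funM => //; apply: measurable_funM; first exact: measurable_cos.
by apply: (measurableT_comp measurable_invr); exact: measurable_sin.
Qed.

Let measurable_feres_uN (b : R) : measurable_fun [set: TR] (fun x : TR => feres_u b (- x) : R).
Proof.
rewrite (_ : (fun x => _) = (fun x : TR => 1 - feres_u b x)).
  by apply: measurable_funB => //; exact: measurable_feres_u.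
by apply/funext => x; rewrite -(feres_u_compl b x); ring.
Qed.

Local Ltac meas_if := repeat first [exact: measurable_feres_u | exact: measurable_feres_uN
  | apply: measurable_cst
  | (apply: measurable_fun_ifT; first by apply: measurable_fun_ltr)
  | apply: measurable_funM | apply: measurable_funB ].

Lemma measurable_feres_p1 (a : R) : measurable_fun [set: TR] (feres_p1 a : TR -> R).
Proof. by rewrite /feres_p1; meas_if. Qed.

Lemma measurable_feres_p2 (a : R) : measurable_fun [set: TR] (feres_p2 a : TR -> R).
Proof. by rewrite /feres_p2; meas_if. Qed.

Lemma measurable_feres_p3 (a : R) : measurable_fun [set: TR] (feres_p3 a : TR -> R).
Proof. by rewrite /feres_p3; meas_if. Qed.

Lemma measurable_feres_p4 (a : R) : measurable_fun [set: TR] (feres_p4 a : TR -> R).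
Proof. by rewrite /feres_p4; meas_if. Qed.

Lemma measurable_feres_T1 (a : R) : measurable_fun [set: TR] (feres_T1 a : TR -> TR).
Proof. exact: measurable_funD. Qed.

Lemma measurable_feres_T2 (a : R) : measurable_fun [set: TR] (feres_T2 a : TR -> TR).
Proof. by apply: measurable_funB => //; apply: measurable_funD => //; exact: measurable_funN. Qed.

Lemma measurable_feres_T3 (a : R) : measurable_fun [set: TR] (feres_T3 a : TR -> TR).
Proof. exact: measurable_funB. Qed.

Lemma measurable_feres_T4 (a : R) : measurable_fun [set: TR] (feres_T4 a : TR -> TR).
Proof. by apply: measurable_funD => //; exact: measurable_funN. Qed.

Lemma Rintegral_sin : \int[mu]_(x in `[0, pi]) sin x = 2 :> R.
Proof.
rewrite /Rintegral (@continuous_FTC2 _ _ (fun x => - cos x)).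
- by rewrite -EFinB /= cospi cos0; ring.
- exact: pi_gt0.
- by apply: continuous_subspaceT; exact: continuous_sin.
- split.
  + by move=> x _; apply: derivableN; exact: derivable_cos.
  + by apply: cvg_at_right_filter; apply: cvgN; exact: continuous_cos.
  + by apply: cvg_at_left_filter; apply: cvgN; exact: continuous_cos.
- move=> x _; rewrite derive1E deriveN; last exact: derivable_cos.
  by rewrite derive_val opprK.
Qed.

End FeresOperator.

(** * Integration against sin x dx *)

Section SineIntegral.
Context {R : realType}.
Local Notation mu := (@lebesgue_measure R).
Local Notation TR := (measurableTypeR R).

(** Left unnormalised: the total mass is 2, and the factor 1/2 reappears only in [feres_muE]. *)
Definition sine_integral (f : R -> R) : R := \int[mu]_(x in `[0, pi]) (sin x * f x).
Local Notation W := sine_integral.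
Implicit Types f g : R -> R.

Let fD : finite_measurable (`[0, (pi : R)]%classic : set TR).
Proof. exact: finite_measurable_itv. Qed.

Let mD : measurable (`[0, (pi : R)]%classic : set TR). Proof. by case: fD. Qed.

Lemma sine_integrable f : bounded_measurable f ->
  mu.-integrable `[0, pi] (EFin \o (fun x => sin x * f x)).
Proof.
move=> bf; apply: bounded_measurable_integrable => //.
by apply: bounded_measurableM => //; exact: bounded_measurable_sin.
Qed.

Lemma sine_integralD f g : bounded_measurable f -> bounded_measurable g ->
  W (fun x => f x + g x) = W f + W g.
Proof.
move=> bf bg; rewrite /W -RintegralD//; [|exact: sine_integrable..].
by apply: eq_Rintegral => x _; rewrite mulrDr.
Qed.

Lemma sine_integralB f g : bounded_measurable f -> bounded_measurable g ->
  W (fun x => f x - g x) = W f - W g.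
Proof.
move=> bf bg; rewrite /W -RintegralB//; [|exact: sine_integrable..].
by apply: eq_Rintegral => x _; rewrite mulrBr.
Qed.

Lemma sine_integralZ (c : R) f : bounded_measurable f ->
  W (fun x => c * f x) = c * W f.
Proof.
move=> bf; rewrite /W -RintegralZl//; last exact: sine_integrable.
by apply: eq_Rintegral => x _; rewrite mulrCA.
Qed.

Lemma sine_integral_cst (c : R) : W (fun=> c) = c * 2.
Proof.
rewrite /W -Rintegral_sin -RintegralZl//.
  by apply: eq_Rintegral => x _; rewrite mulrC.
exact: bounded_measurable_integrable fD bounded_measurable_sin.
Qed.

Lemma le_sine_integral f g : bounded_measurable f -> bounded_measurable g ->
  (forall x, 0 <= x <= pi -> f x <= g x) -> W f <= W g.
Proof.
move=> bf bg fg; apply: le_Rintegral => //; [exact: sine_integrable..|].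
move=> x /=; rewrite in_itv/= => xpi.
by rewrite ler_wpM2l ?fg// sin_ge0_pi.
Qed.

Lemma sine_integral_weight f :
  W f = \int[mu]_x (sin_weight x * f x).
Proof.
rewrite /W Rintegral_mkcond; apply: eq_Rintegral => x _.
rewrite /patch /sin_weight mem_setE in_itv/=.
by case: ifP => _; rewrite ?mul0r.
Qed.

Lemma measurable_sin_weight : measurable_fun [set: TR] (@sin_weight R : TR -> R).
Proof.
rewrite /sin_weight; apply: measurable_fun_ifT => //; last exact: measurable_sin.
by apply: measurable_and; apply: measurable_fun_ler.
Qed.

End SineIntegral.

(** * Self-adjointness and energy of the transition operator *)

Section Operator.
Context {R : realType}.
Local Notation mu := (@lebesgue_measure R).
Local Notation TR := (measurableTypeR R).
Local Notation W := (@sine_integral R).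
Variable a : R.
Hypotheses (a_gt0 : 0 < a) (a_lt : 6 * a < pi).
Local Notation p1 := (feres_p1 a).
Local Notation p2 := (feres_p2 a).
Local Notation p3 := (feres_p3 a).
Local Notation p4 := (feres_p4 a).
Local Notation T1 := (feres_T1 a).
Local Notation T2 := (feres_T2 a).
Local Notation T3 := (feres_T3 a).
Local Notation T4 := (feres_T4 a).
Implicit Types f g h : R -> R.

Definition feres_op (f : R -> R) (x : R) : R :=
  p1 x * f (T1 x) + p2 x * f (T2 x) + p3 x * f (T3 x) + p4 x * f (T4 x).
Local Notation P := feres_op.

Let p1_0 := feres_p1_ge0 a_gt0 a_lt.
Let p2_0 := feres_p2_ge0 a_gt0 a_lt.
Let p3_0 := feres_p3_ge0 a_gt0 a_lt.
Let p4_0 := feres_p4_ge0 a_gt0 a_lt.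
Let psum := feres_p_sum a_gt0 a_lt.

Let bounded_prob (p : R -> R) : measurable_fun [set: TR] p ->
  (forall x, 0 <= p x <= 1) -> bounded_measurable p.
Proof.
move=> mp p01; split=> //; exists 1 => x; have /andP[? ?] := p01 x.
by rewrite ger0_norm.
Qed.

Lemma bounded_measurable_feres_p1 : bounded_measurable p1.
Proof.
apply: bounded_prob; first exact: measurable_feres_p1.
by move=> x; move: (p1_0 x) (p2_0 x) (p3_0 x) (p4_0 x) (psum x) => *; apply/andP; split; lra.
Qed.
Lemma bounded_measurable_feres_p2 : bounded_measurable p2.
Proof.
apply: bounded_prob; first exact: measurable_feres_p2.
by move=> x; move: (p1_0 x) (p2_0 x) (p3_0 x) (p4_0 x) (psum x) => *; apply/andP; split; lra.
Qed.
Lemma bounded_measurable_feres_p3 : bounded_measurable p3.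
Proof.
apply: bounded_prob; first exact: measurable_feres_p3.
by move=> x; move: (p1_0 x) (p2_0 x) (p3_0 x) (p4_0 x) (psum x) => *; apply/andP; split; lra.
Qed.
Lemma bounded_measurable_feres_p4 : bounded_measurable p4.
Proof.
apply: bounded_prob; first exact: measurable_feres_p4.
by move=> x; move: (p1_0 x) (p2_0 x) (p3_0 x) (p4_0 x) (psum x) => *; apply/andP; split; lra.
Qed.

Let bT1 f : bounded_measurable f -> bounded_measurable (fun x => f (T1 x)).
Proof. by move=> bf; apply: bounded_measurable_comp => //; exact: measurable_feres_T1. Qed.
Let bT2 f : bounded_measurable f -> bounded_measurable (fun x => f (T2 x)).
Proof. by move=> bf; apply: bounded_measurable_comp => //; exact: measurable_feres_T2. Qed.
Let bT3 f : bounded_measurable f -> bounded_measurable (fun x => f (T3 x)).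
Proof. by move=> bf; apply: bounded_measurable_comp => //; exact: measurable_feres_T3. Qed.
Let bT4 f : bounded_measurable f -> bounded_measurable (fun x => f (T4 x)).
Proof. by move=> bf; apply: bounded_measurable_comp => //; exact: measurable_feres_T4. Qed.

Local Ltac bm := rewrite /P; repeat first
  [ assumption | exact: bounded_measurable_feres_p1 | exact: bounded_measurable_feres_p2 | exact: bounded_measurable_feres_p3 | exact: bounded_measurable_feres_p4
  | exact: bounded_measurable_cst
  | apply: bounded_measurableB | apply: bounded_measurableD
  | apply: bounded_measurableM
  | apply: bT1 | apply: bT2 | apply: bT3 | apply: bT4 ].

Lemma bounded_measurable_op f : bounded_measurable f -> bounded_measurable (P f).
Proof. by move=> bf; bm. Qed.

Lemma feres_op_norm_le f (M : R) : (forall x, `|f x| <= M) -> forall x, `|P f x| <= M.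
Proof.
move=> fM x; rewrite /P.
have := fM (T1 x); have := fM (T2 x); have := fM (T3 x); have := fM (T4 x).
rewrite !ler_norml.
move: (p1_0 x) (p2_0 x) (p3_0 x) (p4_0 x) (psum x).
move: (p1 x) (p2 x) (p3 x) (p4 x) (f (T1 x)) (f (T2 x)) (f (T3 x)) (f (T4 x)).
move=> q1 q2 q3 q4 f1 f2 f3 f4 h1 h2 h3 h4 hs /andP[? ?] /andP[? ?] /andP[? ?] /andP[? ?].
have -> : M = q1 * M + q2 * M + q3 * M + q4 * M by rewrite -!mulrDl hs mul1r.
rewrite !opprD -!mulrN; apply/andP; split; rewrite !lerD// ler_wpM2l//.
Qed.

Lemma feres_op_cst (c : R) : P (fun=> c) = fun=> c.
Proof. by apply/funext => x; rewrite /P -!mulrDl psum mul1r. Qed.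

Lemma feres_opB f g : P (fun x => f x - g x) = (fun x => P f x - P g x).
Proof. by apply/funext => x; rewrite /P; ring. Qed.

(* Detailed balance: each branch of the walk is undone by a branch of the
   same weight with respect to [sin x dx] (1 by 3, 2 by 2, 4 by 4). *)
Let transport (p q : R -> R) (T T' : R -> R) f g :
  (forall x, sin_weight x * p x = sin_weight (T x) * q (T x)) ->
  cancel T T' ->
  (forall h : R -> R, measurable_fun [set: TR] h -> \int[mu]_x h (T x) = \int[mu]_x h x) ->
  measurable_fun [set: TR] q -> measurable_fun [set: TR] (T' : TR -> TR) ->
  bounded_measurable f -> bounded_measurable g ->
  W (fun x => p x * f (T x) * g x) = W (fun x => q x * f x * g (T' x)).
Proof.
move=> bal TK inv mq mT' [mf _] [mg _]; rewrite !sine_integral_weight.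
rewrite -[RHS]inv; last first.
  apply: measurable_funM; first exact: measurable_sin_weight.
  by apply: measurable_funM; [exact: measurable_funM|exact: measurableT_comp].
by apply: eq_Rintegral => x _; rewrite TK !mulrA bal.
Qed.

Lemma feres_op_sym f g : bounded_measurable f -> bounded_measurable g ->
  W (fun x => P f x * g x) = W (fun x => f x * P g x).
Proof.
move=> bf bg.
have e13 f' g' : bounded_measurable f' -> bounded_measurable g' ->
    W (fun x => p1 x * f' (T1 x) * g' x) = W (fun x => p3 x * f' x * g' (T3 x)).
  move=> bf' bg'; apply: transport => //.
  - exact: detailed_balance13.
  - by move=> x; rewrite /feres_T1 /feres_T3; ring.
  - by move=> h mh; exact: Rintegral_shift.
  - exact: measurable_feres_p3.
  - exact: measurable_feres_T3.
have e22 : W (fun x => p2 x * f (T2 x) * g x) = W (fun x => p2 x * f x * g (T2 x)).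
  apply: transport => //.
  - exact: detailed_balance22.
  - by move=> x; rewrite /feres_T2; ring.
  - move=> h mh; rewrite -[RHS](Rintegral_reflect (2 * pi - 4 * a))//.
    by apply: eq_Rintegral => x _; congr h; rewrite /feres_T2; ring.
  - exact: measurable_feres_p2.
  - exact: measurable_feres_T2.
have e44 : W (fun x => p4 x * f (T4 x) * g x) = W (fun x => p4 x * f x * g (T4 x)).
  apply: transport => //.
  - exact: detailed_balance44.
  - by move=> x; rewrite /feres_T4; ring.
  - move=> h mh; rewrite -[RHS](Rintegral_reflect (4 * a))//.
    by apply: eq_Rintegral => x _; congr h; rewrite /feres_T4; ring.
  - exact: measurable_feres_p4.
  - exact: measurable_feres_T4.
have -> : (fun x => P f x * g x) = (fun x => p1 x * f (T1 x) * g x +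
    p2 x * f (T2 x) * g x + p3 x * f (T3 x) * g x + p4 x * f (T4 x) * g x).
  by apply/funext => x; rewrite /P; ring.
have -> : (fun x => f x * P g x) = (fun x => p3 x * f x * g (T3 x) +
    p2 x * f x * g (T2 x) + p1 x * f x * g (T1 x) + p4 x * f x * g (T4 x)).
  by apply/funext => x; rewrite /P; ring.
rewrite !sine_integralD; try by bm.
rewrite e13// e22 e44; congr (_ + _ + _ + _).
(* What remains is the branch 3 term, which is the balance of branches 1 and 3 with the roles of f
   and g exchanged. *)
have := e13 g f bg bf.
have -> : (fun x => p1 x * g (T1 x) * f x) = (fun x => p1 x * f x * g (T1 x)).
  by apply/funext => x; ring.
by move=> ->; congr W; apply/funext => x; ring.
Qed.

(** Invariance of the sine law: self-adjointness tested against the constant 1, which [P] fixes. *)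
Lemma sine_integral_op f : bounded_measurable f -> W (P f) = W f.
Proof.
move=> bf; have := feres_op_sym bf (bounded_measurable_cst 1).
rewrite feres_op_cst.
under eq_fun do rewrite mulr1.
by under [X in _ = W X -> _]eq_fun do rewrite mulr1.
Qed.

(** Stated as a difference so that it telescopes along the iterates; [energyE] gives the variance
    form used for lower bounds. *)
Definition feres_energy f := W (fun x => f x * f x) - W (fun x => P f x * P f x).

Let energyE f : bounded_measurable f ->
  feres_energy f = W (fun x => P (fun y => f y * f y) x - P f x * P f x).
Proof.
move=> bf; have bff : bounded_measurable (fun y => f y * f y) by bm.
by rewrite sine_integralB ?sine_integral_op//; bm.
Qed.

(* The variance of f(T x) under the transition probabilities. *)
Let variance f x : P (fun y => f y * f y) x - P f x * P f x =
  p1 x * p2 x * (f (T1 x) - f (T2 x)) ^+ 2 + p1 x * p3 x * (f (T1 x) - f (T3 x)) ^+ 2 +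
  p1 x * p4 x * (f (T1 x) - f (T4 x)) ^+ 2 + p2 x * p3 x * (f (T2 x) - f (T3 x)) ^+ 2 +
  p2 x * p4 x * (f (T2 x) - f (T4 x)) ^+ 2 + p3 x * p4 x * (f (T3 x) - f (T4 x)) ^+ 2.
Proof.
rewrite /P; have -> : p1 x = 1 - p2 x - p3 x - p4 x by rewrite -(psum x); ring.
by ring.
Qed.

Let pq (p q t : R) : 0 <= p -> 0 <= q -> 0 <= p * q * t ^+ 2.
Proof. by move=> *; rewrite mulr_ge0 ?sqr_ge0 ?mulr_ge0. Qed.

(** These pairs carry the three symmetries: [T1] and [T3] differ by the shift 4 alpha, [T1] and [T4]
    are exchanged by the reflection about 3 alpha, [T2] and [T3] by that about pi - 3 alpha. *)
Let variance_ge f x :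
  [/\ p1 x * p3 x * (f (T1 x) - f (T3 x)) ^+ 2 <= P (fun y => f y * f y) x - P f x * P f x,
      p1 x * p4 x * (f (T1 x) - f (T4 x)) ^+ 2 <= P (fun y => f y * f y) x - P f x * P f x &
      p2 x * p3 x * (f (T2 x) - f (T3 x)) ^+ 2 <= P (fun y => f y * f y) x - P f x * P f x].
Proof.
have := (pq (f (T1 x) - f (T2 x)) (p1_0 x) (p2_0 x), pq (f (T1 x) - f (T3 x)) (p1_0 x) (p3_0 x),
  pq (f (T1 x) - f (T4 x)) (p1_0 x) (p4_0 x), pq (f (T2 x) - f (T3 x)) (p2_0 x) (p3_0 x),
  pq (f (T2 x) - f (T4 x)) (p2_0 x) (p4_0 x), pq (f (T3 x) - f (T4 x)) (p3_0 x) (p4_0 x)).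
rewrite variance.
move: (p1 x * p2 x * _) (p1 x * p3 x * _) (p1 x * p4 x * _) (p2 x * p3 x * _)
  (p2 x * p4 x * _) (p3 x * p4 x * _) => v12 v13 v14 v23 v24 v34 [[[[[]]]]] *.
by split; lra.
Qed.

Lemma feres_energy13 f : bounded_measurable f ->
  W (fun x => p1 x * p3 x * (f (T1 x) - f (T3 x)) ^+ 2) <= feres_energy f.
Proof.
move=> bf; rewrite energyE//; apply: le_sine_integral.
- by under eq_fun do rewrite expr2; bm.
- by bm.
- by move=> x _; case: (variance_ge f x).
Qed.

Lemma feres_energy14 f : bounded_measurable f ->
  W (fun x => p1 x * p4 x * (f (T1 x) - f (T4 x)) ^+ 2) <= feres_energy f.
Proof.
move=> bf; rewrite energyE//; apply: le_sine_integral.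
- by under eq_fun do rewrite expr2; bm.
- by bm.
- by move=> x _; case: (variance_ge f x).
Qed.

Lemma feres_energy23 f : bounded_measurable f ->
  W (fun x => p2 x * p3 x * (f (T2 x) - f (T3 x)) ^+ 2) <= feres_energy f.
Proof.
move=> bf; rewrite energyE//; apply: le_sine_integral.
- by under eq_fun do rewrite expr2; bm.
- by bm.
- by move=> x _; case: (variance_ge f x).
Qed.

Lemma feres_energy_ge0 f : bounded_measurable f -> 0 <= feres_energy f.
Proof.
move=> bf; apply: le_trans (feres_energy13 bf).
rewrite -(mul0r 2) -sine_integral_cst; apply: le_sine_integral.
- exact: bounded_measurable_cst.
- by under eq_fun do rewrite expr2; bm.
- by move=> x _; exact: pq.
Qed.

Lemma bounded_measurable_iter n f : bounded_measurable f ->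
  bounded_measurable (iter n P f).
Proof. by move=> bf; elim: n => //= n; exact: bounded_measurable_op. Qed.

Lemma sine_integral_iter m n f : bounded_measurable f ->
  W (fun x => iter m P f x * iter n P f x) = W (fun x => iter (m + n) P f x * f x).
Proof.
move=> bf; elim: n m => [|n IHn] m; first by rewrite addn0.
rewrite addnS -addSn -IHn /=.
by rewrite feres_op_sym//; exact: bounded_measurable_iter.
Qed.

End Operator.

(** * Integrals over intervals and their end points *)

Section IntervalIntegrals.
Context {R : realType}.
Local Notation mu := (@lebesgue_measure R).
Local Notation TR := (measurableTypeR R).
Implicit Types (f phi v : R -> R) (a b c d : R).

Lemma bounded_itv_integrable f a b : bounded_measurable f ->
  mu.-integrable `[a, b] (EFin \o f).
Proof.
by move=> bf; apply: bounded_measurable_integrable => //; exact: finite_measurable_itv.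
Qed.

Lemma Rintegral_itv_congr f a b c d : a = c -> b = d ->
  \int[mu]_(x in `[a, b]) f x = \int[mu]_(x in `[c, d]) f x.
Proof. by move=> -> ->. Qed.

Lemma Rintegral_itv_cst a b (r : R) : a <= b ->
  \int[mu]_(_ in `[a, b]) r = r * (b - a).
Proof.
move=> ab; rewrite Rintegral_cst; last exact: measurable_itv.
have e : fine (mu `[a, b]%classic) = b - a.
  rewrite lebesgue_measure_itv/= lte_fin; move: ab.
  by rewrite le_eqVlt => /predU1P[->|->]//; rewrite ltxx subrr.
by congr (_ * _); exact: e.
Qed.

Lemma Rintegral_itv_split f a b c : bounded_measurable f -> a <= b -> b <= c ->
  \int[mu]_(x in `[a, c]) f x - \int[mu]_(x in `[a, b]) f x =
  \int[mu]_(x in `[b, c]) f x.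
Proof.
move=> bf ab bc; rewrite Rintegral_itvB ?bnd_simp//; last exact: bounded_itv_integrable.
rewrite Rintegral_itv_obnd_cbnd//.
apply: (integrableS _ _ _ (bounded_itv_integrable b c bf)) => //.
by move=> x /=; rewrite !in_itv/= => /andP[/ltW -> ->].
Qed.

Lemma integrable_open_of_closed f a b : mu.-integrable `[a, b] (EFin \o f) ->
  mu.-integrable `]a, b[ (EFin \o f).
Proof.
move=> intf; apply: (integrableS _ _ _ intf) => //.
by move=> x /=; rewrite !in_itv/= => /andP[/ltW -> /ltW ->].
Qed.

Lemma Rintegral_open_closed f a b : mu.-integrable `[a, b] (EFin \o f) ->
  \int[mu]_(x in `]a, b[) f x = \int[mu]_(x in `[a, b]) f x.
Proof.
move=> intf; rewrite Rintegral_itv_bndo_bndc; last first.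
  apply: (integrableS _ _ _ intf) => //.
  by move=> x /=; rewrite !in_itv/= => /andP[/ltW -> /ltW ->].
rewrite Rintegral_itv_obnd_cbnd//.
apply: (integrableS _ _ _ intf) => //.
by move=> x /=; rewrite !in_itv/= => /andP[/ltW -> ->].
Qed.

Lemma Rintegral_itv_le_sub f a b c d : bounded_measurable f -> c <= a -> b <= d ->
  (forall x, c <= x <= d -> 0 <= f x) ->
  \int[mu]_(x in `[a, b]) f x <= \int[mu]_(x in `[c, d]) f x.
Proof.
move=> bf ca bd f0; rewrite /Rintegral fine_le//.
- by apply: integrable_fin_num => //; exact: bounded_itv_integrable.
- by apply: integrable_fin_num => //; exact: bounded_itv_integrable.
- apply: ge0_subset_integral => //=.
  + by apply/measurable_EFinP; apply: measurable_funTS; case: bf.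
  + by move=> x /=; rewrite !in_itv/= => /andP[/(le_trans ca) -> /le_trans ->].
Qed.

(** Positivity is asked only inside the interval, since sin and the branch weights may vanish at the
    ends; the end points are null. *)
Lemma small_of_weighted_square_itv c d phi v (M : R) : bounded_measurable phi ->
  measurable_fun [set: TR] v ->
  (forall x, c < x < d -> 0 < phi x) -> (forall x, c < x < d -> 0 <= v x) ->
  mu.-integrable `[c, d] (EFin \o v) ->
  forall e : R, 0 < e -> exists2 delta : R, 0 < delta &
    forall u : R -> R, measurable_fun [set: TR] u -> (forall x, `|u x| <= M) ->
      \int[mu]_(x in `[c, d]) (phi x * u x ^+ 2) < delta ->
      \int[mu]_(x in `[c, d]) (v x * `|u x|) < e.
Proof.
move=> bphi mv phi0 v0 iv e e0.
have [delta delta0 H] := @small_of_weighted_square R `]c, d[%classic phi v M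
  (measurable_itv _) bphi.1 mv phi0 v0
  (integrable_open_of_closed (bounded_itv_integrable c d bphi))
  (integrable_open_of_closed iv) e e0.
exists delta => // u mu' uM; rewrite -!Rintegral_open_closed.
- exact: H.
- apply: (integrable_mul_bounded _ iv) => //.
  by apply: bounded_measurable_norm; split=> //; exists M.
- apply: bounded_itv_integrable; apply: bounded_measurableM => //.
  under eq_fun do rewrite expr2.
  by apply: bounded_measurableM; split=> //; exists M.
Qed.

Lemma cvg_of_cauchy (u : nat -> R) :
  (forall e : R, 0 < e -> exists N, forall n k, (N <= n)%N -> (N <= k)%N -> `|u n - u k| < e) ->
  cvg (u @ \oo).
Proof.
move=> uC; apply: cauchy_cvg; apply/cauchy_ballP => e e0.
have [N HN] := uC e e0.
exists ([set x | exists2 n, (N <= n)%N & x = u n], [set x | exists2 n, (N <= n)%N & x = u n]) => /=.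
  by split; exists N => // n Nn /=; exists n.
by move=> [x y] [/= [n Nn ->] [k Nk ->]]; rewrite -ball_normE /=; exact: HN.
Qed.

End IntervalIntegrals.

(** * Decay of the iterates *)

Section Decay.
Context {R : realType}.
Local Notation mu := (@lebesgue_measure R).
Local Notation TR := (measurableTypeR R).
Local Notation W := (@sine_integral R).
Variable a : R.
Hypotheses (a_gt0 : 0 < a) (a_lt : 6 * a < pi) (a_irr : irrational (a / pi)).
Variable h : R -> R.
Hypotheses (bh : bounded_measurable h) (h_le1 : forall x, `|h x| <= 1).
Hypothesis h_mean : W h = 0.
Local Notation P := (feres_op a).
Local Notation p1 := (feres_p1 a).
Local Notation p2 := (feres_p2 a).
Local Notation p3 := (feres_p3 a).
Local Notation p4 := (feres_p4 a).
Local Notation T1 := (feres_T1 a).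
Local Notation T2 := (feres_T2 a).
Local Notation T3 := (feres_T3 a).
Local Notation T4 := (feres_T4 a).

Let f n := iter n P h.

Let bf n : bounded_measurable (f n).
Proof. exact: bounded_measurable_iter. Qed.

Let mf n : measurable_fun [set: TR] (f n). Proof. by case: (bf n). Qed.

Let f_le1 n x : `|f n x| <= 1.
Proof. by elim: n x => [|n IHn] //=; exact: feres_op_norm_le. Qed.

Let bff m n : bounded_measurable (fun x => f m x * f n x).
Proof. exact: bounded_measurableM. Qed.

Let normf n := W (fun x => f n x * f n x).

Let W_ff m n : W (fun x => f m x * f n x) = W (fun x => f (m + n) x * h x).
Proof. exact: sine_integral_iter. Qed.

Let normf_ge0 n : 0 <= normf n.
Proof.
rewrite -(mul0r 2) -sine_integral_cst; apply: le_sine_integral => //.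
  exact: bounded_measurable_cst.
by move=> x _; rewrite -expr2 sqr_ge0.
Qed.

Let energy_normf n : feres_energy a (f n) = normf n - normf n.+1.
Proof. by []. Qed.

Let normf_cvg : cvg (normf n @[n --> \oo]).
Proof.
apply: nonincreasing_is_cvgn.
  apply/nonincreasing_seqP => n.
  by rewrite -subr_ge0 -energy_normf; exact: feres_energy_ge0.
by exists 0 => _ [n _ <-].
Qed.

Let energy_cvg0 : feres_energy a (f n) @[n --> \oo] --> (0 : R).
Proof.
have c1 := normf_cvg.
have c2 : normf n.+1 @[n --> \oo] --> lim (normf n @[n --> \oo]).
  by move: c1; rewrite -(cvg_shiftS normf).
by have := cvgB c1 c2; rewrite subrr; exact.
Qed.

(** The cross term pairs [f] at index 2 n + 2 k with h; splitting that index in equal halves makes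
    it the squared norm at n + k. *)
Let norm_sub n k : W (fun x => (f (n + n) x - f (k + k) x) ^+ 2) =
  normf (n + n) + normf (k + k) - 2 * normf (n + k).
Proof.
have -> : (fun x => (f (n + n) x - f (k + k) x) ^+ 2) =
    (fun x => f (n + n) x * f (n + n) x + f (k + k) x * f (k + k) x -
              2 * (f (n + n) x * f (k + k) x)).
  by apply/funext => x; ring.
have b2 : bounded_measurable (fun x => 2 * (f (n + n) x * f (k + k) x)).
  by apply: bounded_measurableM => //; exact: bounded_measurable_cst.
have b1 : bounded_measurable
    (fun x => f (n + n) x * f (n + n) x + f (k + k) x * f (k + k) x).
  exact: bounded_measurableD.
rewrite sine_integralB// sine_integralD// sine_integralZ//; congr (_ - 2 * _).
by rewrite /normf !W_ff; congr W; apply/funext => x; rewrite addnACA.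
Qed.

Let norm_cauchy (e : R) : 0 < e -> exists N, forall n k, (N <= n)%N -> (N <= k)%N ->
  W (fun x => (f (n + n) x - f (k + k) x) ^+ 2) < e.
Proof.
(* The three norms enter with coefficients 1, 1 and -2: their common limit cancels, and the errors
   add up to four times e / 4. *)
move=> e0; have e4 : 0 < e / 4 by rewrite divr_gt0.
have /cvgrPdist_lt/(_ _ e4)[N _ HN] := normf_cvg.
exists N => n k Nn Nk; rewrite norm_sub.
have := HN (n + n)%N (leq_trans Nn (leq_addr _ _)).
have := HN (k + k)%N (leq_trans Nk (leq_addr _ _)).
have := HN (n + k)%N (leq_trans Nn (leq_addr _ _)).
rewrite /= !ltr_distl => /andP[? ?] /andP[? ?] /andP[? ?].
by lra.
Qed.

Let F n (x : R) := \int[mu]_(t in `[0, x]) f (n + n) t.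

(** Cauchy for the sine weight implies Cauchy in L^1(dx); the constant 2 bounds a difference of two
    iterates bounded by 1. *)
Let F_cauchy (x : R) : 0 <= x <= pi ->
  forall e : R, 0 < e -> exists N, forall n k, (N <= n)%N -> (N <= k)%N -> `|F n x - F k x| < e.
Proof.
move=> /andP[x0 xpi] e e0.
have [delta delta0 H] := @small_of_weighted_square_itv R 0 pi (fun t => sin t) (fun=> 1) 2
  bounded_measurable_sin (measurable_cst _) (fun t => @sin_gt0_pi R t) (fun _ _ => ler01)
  (bounded_itv_integrable _ _ (bounded_measurable_cst _)) e e0.
have [N HN] := norm_cauchy delta0.
exists N => n k Nn Nk.
have bu : bounded_measurable (fun t => f (n + n) t - f (k + k) t).
  exact: bounded_measurableB.
rewrite /F -RintegralB//; [|exact: bounded_itv_integrable..].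
apply: le_lt_trans (H (fun t => f (n + n) t - f (k + k) t) bu.1 _ (HN n k Nn Nk)).
  apply: (le_trans (le_normr_Rintegral _ (bounded_itv_integrable _ _ bu))) => //.
  under [leRHS]eq_Rintegral do rewrite mul1r.
  apply: Rintegral_itv_le_sub => //.
  exact: bounded_measurable_norm.
move=> t; apply: (le_trans (ler_normB _ _)).
by rewrite [leRHS](_ : 2 = 1 + 1)// lerD.
Qed.

Let Flim x := lim (F n x @[n --> \oo]).

Let F_cvg x : 0 <= x <= pi -> F n x @[n --> \oo] --> Flim x.
Proof. by move=> /F_cauchy/cvg_of_cauchy. Qed.

Let F_le n x : 0 <= x -> `|F n x| <= x.
Proof.
move=> x0; have := @Rintegral_norm_le _ _ (f (n + n)) 1 (finite_measurable_itv 0 x)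
  (bf _) (fun t _ => f_le1 _ t).
rewrite mul1r lebesgue_measure_itv/= lte_fin.
case: ifP => _ /=; first by rewrite subr0.
by move/le_trans; apply.
Qed.

Let F_sub n x y : 0 <= x -> x <= y ->
  F n y - F n x = \int[mu]_(t in `[x, y]) f (n + n) t.
Proof. by move=> x0 xy; exact: Rintegral_itv_split. Qed.

(** The vanishing energy dominates the squared difference of the two branches with weight p q sin,
    which is positive inside [c, d]; this weight is then exchanged for 1. *)
Let branches_merge (p q : R -> R) (T T' : R -> R) (c d : R) :
  bounded_measurable p -> bounded_measurable q ->
  measurable_fun [set: TR] (T : TR -> TR) -> measurable_fun [set: TR] (T' : TR -> TR) ->
  (forall x, 0 <= p x) -> (forall x, 0 <= q x) ->
  0 <= c -> d <= pi ->
  (forall x, c < x < d -> 0 < p x /\ 0 < q x) ->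
  (forall g, bounded_measurable g ->
    W (fun x => p x * q x * (g (T x) - g (T' x)) ^+ 2) <= feres_energy a g) ->
  (\int[mu]_(t in `[c, d]) f (n + n) (T t) -
   \int[mu]_(t in `[c, d]) f (n + n) (T' t)) @[n --> \oo] --> (0 : R).
Proof.
move=> bp bq mT mT' p0 q0 c0 dpi pq energy.
have bphi : bounded_measurable (fun x => sin x * (p x * q x)).
  apply: bounded_measurableM; first exact: bounded_measurable_sin.
  exact: bounded_measurableM.
have phi0 x : c < x < d -> 0 < sin x * (p x * q x).
  move=> cxd; have [px qx] := pq x cxd; rewrite !mulr_gt0//.
  move: cxd => /andP[cx xd]; apply: sin_gt0_pi.
  by rewrite (le_lt_trans c0 cx) (lt_le_trans xd dpi).
apply/cvgrPdist_lt => e e0.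
have [delta delta0 H] := @small_of_weighted_square_itv R c d _ (fun=> 1) 2
  bphi (measurable_cst _) phi0 (fun _ _ => ler01)
  (bounded_itv_integrable _ _ (bounded_measurable_cst _)) e e0.
have /cvgrPdist_lt/(_ _ delta0)[N _ HN] := energy_cvg0.
exists N => // n Nn /=; rewrite sub0r normrN.
set u := fun t => f (n + n) (T t) - f (n + n) (T' t).
have bT : bounded_measurable (fun t => f (n + n) (T t)).
  exact: bounded_measurable_comp.
have bT' : bounded_measurable (fun t => f (n + n) (T' t)).
  exact: bounded_measurable_comp.
have bu : bounded_measurable u by exact: bounded_measurableB.
rewrite -RintegralB//; [|exact: bounded_itv_integrable..].
apply: (le_lt_trans (le_normr_Rintegral _ (bounded_itv_integrable _ _ bu))) => //.
have -> : \int[mu]_(t in `[c, d]) `|u t| = \int[mu]_(t in `[c, d]) (1 * `|u t|).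
  by apply: eq_Rintegral => t _; rewrite mul1r.
apply: H.
- exact: bu.1.
- move=> t; apply: (le_trans (ler_normB _ _)).
  by rewrite [leRHS](_ : 2 = 1 + 1)// lerD.
- have bpu : bounded_measurable (fun x => p x * q x * u x ^+ 2).
    under eq_fun do rewrite expr2.
    by apply: bounded_measurableM; exact: bounded_measurableM.
  apply: (@le_lt_trans _ _ (W (fun x => p x * q x * u x ^+ 2))).
    rewrite /sine_integral; under eq_Rintegral do rewrite -mulrA.
    apply: Rintegral_itv_le_sub => //.
      by apply: bounded_measurableM => //; exact: bounded_measurable_sin.
    by move=> x xpi; rewrite mulr_ge0 ?sin_ge0_pi// mulr_ge0 ?sqr_ge0// mulr_ge0.
  apply: (le_lt_trans (energy _ (bf (n + n)))).
  have /= := HN (n + n)%N (leq_trans Nn (leq_addr _ _)).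
  by rewrite sub0r normrN; apply: le_lt_trans; exact: ler_norm.
Qed.

Let cvg_unique_sub (u v : nat -> R) (l l' : R) : u n @[n --> \oo] --> l -> v n @[n --> \oo] --> l' ->
  (u n - v n) @[n --> \oo] --> (0 : R) -> l = l'.
Proof.
move=> ul vl uv0; apply/eqP; rewrite -subr_eq0; apply/eqP.
exact: (cvg_unique _ (cvgB ul vl) uv0).
Qed.

(** The common starting points fill [x + 2 alpha, y + 2 alpha], inside [2 alpha, pi - 2 alpha],
    where branches 1 and 3 are both open: one leads to the interval shifted by 4 alpha, the other
    back to [x, y]. *)
Let Flim_shift x y : 0 <= x -> x <= y -> y <= pi - 4 * a ->
  Flim (y + 4 * a) - Flim (x + 4 * a) = Flim y - Flim x.
Proof.
move: (a_gt0) (a_lt) => a0 al x0 xy yp.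
have Fc z : 0 <= z <= pi -> F n z @[n --> \oo] --> Flim z by exact: F_cvg.
apply: (@cvg_unique_sub (fun n => F n (y + 4 * a) - F n (x + 4 * a)) (fun n => F n y - F n x)).
- by apply: cvgB; apply: Fc; apply/andP; split; lra.
- by apply: cvgB; apply: Fc; apply/andP; split; lra.
have := @branches_merge p1 p3 T1 T3 (x + 2 * a) (y + 2 * a).
have -> : (fun n => F n (y + 4 * a) - F n (x + 4 * a) - (F n y - F n x)) =
  (fun n => \int[mu]_(t in `[x + 2 * a, y + 2 * a]) f (n + n) (T1 t) -
   \int[mu]_(t in `[x + 2 * a, y + 2 * a]) f (n + n) (T3 t)).
  apply/funext => n; rewrite F_sub; [|lra..]; rewrite F_sub; [|lra..].
  congr (_ - _).
    rewrite (Rintegral_itv_shift _ _ (2 * a))//.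
    by apply: Rintegral_itv_congr; ring.
  rewrite (Rintegral_itv_shift _ _ (- (2 * a)))//.
  by apply: Rintegral_itv_congr; ring.
apply.
- exact: bounded_measurable_feres_p1.
- exact: bounded_measurable_feres_p3.
- exact: measurable_feres_T1.
- exact: measurable_feres_T3.
- exact: feres_p1_ge0.
- exact: feres_p3_ge0.
- by lra.
- by lra.
- move=> z /andP[? ?]; split; first by apply: feres_p1_gt0 => //; lra.
  by apply: feres_p3_gt0 => //; lra.
- by move=> g; exact: feres_energy13.
Qed.

(** Starting points in [x - 2 alpha, y - 2 alpha], inside the support [alpha, 3 alpha] of branch 4;
    branch 1 leads to [x, y] and branch 4 to its mirror image about 3 alpha. *)
Let Flim_reflect0 x y : 3 * a <= x -> x <= y -> y <= 5 * a ->
  Flim y - Flim x = Flim (6 * a - x) - Flim (6 * a - y).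
Proof.
move: (a_gt0) (a_lt) => a0 al x0 xy yp.
have Fc z : 0 <= z <= pi -> F n z @[n --> \oo] --> Flim z by exact: F_cvg.
apply: (@cvg_unique_sub (fun n => F n y - F n x) (fun n => F n (6 * a - x) - F n (6 * a - y))).
- by apply: cvgB; apply: Fc; apply/andP; split; lra.
- by apply: cvgB; apply: Fc; apply/andP; split; lra.
have := @branches_merge p1 p4 T1 T4 (x - 2 * a) (y - 2 * a).
have -> : (fun n => F n y - F n x - (F n (6 * a - x) - F n (6 * a - y))) =
  (fun n => \int[mu]_(t in `[x - 2 * a, y - 2 * a]) f (n + n) (T1 t) -
   \int[mu]_(t in `[x - 2 * a, y - 2 * a]) f (n + n) (T4 t)).
  apply/funext => n; rewrite F_sub; [|lra..]; rewrite F_sub; [|lra..].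
  congr (_ - _).
    rewrite (Rintegral_itv_shift _ _ (2 * a))//.
    by apply: Rintegral_itv_congr; ring.
  have -> : \int[mu]_(t in `[x - 2 * a, y - 2 * a]) f (n + n) (T4 t) =
      \int[mu]_(t in `[x - 2 * a, y - 2 * a]) f (n + n) (4 * a - t).
    by apply: eq_Rintegral => t _; congr (f _ _); rewrite /feres_T4; ring.
  rewrite Rintegral_itv_reflect//.
  by apply: Rintegral_itv_congr; ring.
apply.
- exact: bounded_measurable_feres_p1.
- exact: bounded_measurable_feres_p4.
- exact: measurable_feres_T1.
- exact: measurable_feres_T4.
- exact: feres_p1_ge0.
- exact: feres_p4_ge0.
- by lra.
- by lra.
- move=> z /andP[? ?]; split; first by apply: feres_p1_gt0 => //; lra.
  by apply: feres_p4_gt0 => //; lra.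
- by move=> g; exact: feres_energy14.
Qed.

(** Starting points in [x + 2 alpha, y + 2 alpha], inside the support [pi - 3 alpha, pi - alpha] of
    branch 2; branch 3 leads to [x, y] and branch 2 to its mirror image about pi - 3 alpha. *)
Let Flim_reflectpi x y : pi - 5 * a <= x -> x <= y -> y <= pi - 3 * a ->
  Flim y - Flim x = Flim (2 * pi - 6 * a - x) - Flim (2 * pi - 6 * a - y).
Proof.
move: (a_gt0) (a_lt) => a0 al x0 xy yp.
have Fc z : 0 <= z <= pi -> F n z @[n --> \oo] --> Flim z by exact: F_cvg.
apply/esym.
apply: (@cvg_unique_sub (fun n => F n (2 * pi - 6 * a - x) - F n (2 * pi - 6 * a - y)) (fun n => F n y - F n x)).
- by apply: cvgB; apply: Fc; apply/andP; split; lra.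
- by apply: cvgB; apply: Fc; apply/andP; split; lra.
have := @branches_merge p2 p3 T2 T3 (x + 2 * a) (y + 2 * a).
have -> : (fun n => F n (2 * pi - 6 * a - x) - F n (2 * pi - 6 * a - y) - (F n y - F n x)) =
  (fun n => \int[mu]_(t in `[x + 2 * a, y + 2 * a]) f (n + n) (T2 t) -
   \int[mu]_(t in `[x + 2 * a, y + 2 * a]) f (n + n) (T3 t)).
  apply/funext => n; rewrite F_sub; [|lra..]; rewrite F_sub; [|lra..].
  congr (_ - _).
    have -> : \int[mu]_(t in `[x + 2 * a, y + 2 * a]) f (n + n) (T2 t) =
        \int[mu]_(t in `[x + 2 * a, y + 2 * a]) f (n + n) (2 * pi - 4 * a - t).
      by apply: eq_Rintegral => t _; congr (f _ _); rewrite /feres_T2; ring.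
    rewrite Rintegral_itv_reflect//.
    by apply: Rintegral_itv_congr; ring.
  rewrite (Rintegral_itv_shift _ _ (- (2 * a)))//.
  by apply: Rintegral_itv_congr; ring.
apply.
- exact: bounded_measurable_feres_p2.
- exact: bounded_measurable_feres_p3.
- exact: measurable_feres_T2.
- exact: measurable_feres_T3.
- exact: feres_p2_ge0.
- exact: feres_p3_ge0.
- by lra.
- by lra.
- move=> z /andP[? ?]; split; first by apply: feres_p2_gt0 => //; lra.
  by apply: feres_p3_gt0 => //; lra.
- by move=> g; exact: feres_energy23.
Qed.

Let Flim_le x : 0 <= x <= pi -> `|Flim x| <= x.
Proof.
move=> xpi; have x0 : 0 <= x by case/andP: xpi.
have c : `|F n x| @[n --> \oo] --> `|Flim x| by apply: cvg_norm; exact: F_cvg.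
rewrite -(cvg_lim _ c)//; apply: limr_le; first by apply/cvg_ex; exists `|Flim x|.
by apply: nearW => n; exact: F_le.
Qed.

Lemma sine_norm_iter_cvg0 :
  W (fun x => iter n P h x * iter n P h x) @[n --> \oo] --> (0 : R).
Proof.
have [c Fc] := linear_of_local_symmetries a_gt0 a_lt a_irr Flim_le Flim_shift
  Flim_reflect0 Flim_reflectpi.
pose g n x := f (n + n) x - c.
have bg n : bounded_measurable (g n).
  by apply: bounded_measurableB => //; exact: bounded_measurable_cst.
have gM n x : `|g n x| <= 1 + `|c| by apply: (le_trans (ler_normB _ _)); rewrite lerD2r.
have g_itv x y : 0 <= x -> x <= y -> y <= pi ->
    (\int[mu]_(t in `[x, y]) g n t) @[n --> \oo] --> (0 : R).
  move=> x0 xy ypi.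
  have xpi : 0 <= x <= pi by rewrite x0 (le_trans xy).
  have y0pi : 0 <= y <= pi by rewrite (le_trans x0).
  have e n : \int[mu]_(t in `[x, y]) g n t = F n y - F n x - c * (y - x).
    rewrite RintegralB//; [|exact: bounded_itv_integrable|
      by apply: bounded_itv_integrable; exact: bounded_measurable_cst].
    by rewrite F_sub// Rintegral_itv_cst.
  under eq_fun do rewrite e.
  have := cvgB (cvgB (F_cvg y0pi) (F_cvg xpi)) (cvg_cst (c * (y - x))).
  by rewrite !Fc// mulrBr subrr; exact.
have weak := weak_null_integrable (fun n => (bg n).1) gM g_itv.
(* The test function is sin itself: every iterate has sine integral 0, so the pairing is constantly
   - 2 c. *)
have c0 : c = 0.
  have h1 := weak _ (bounded_itv_integrable _ _ bounded_measurable_sin).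
  have e n : \int[mu]_(x in `[0, pi]) (sin x * g n x) = - (c * 2).
    rewrite -/(sine_integral (g n)) sine_integralB//; last exact: bounded_measurable_cst.
    rewrite sine_integral_cst; suff -> : W (f (n + n)) = 0 by rewrite sub0r.
    by elim: (n + n)%N => //= m IHm; rewrite sine_integral_op.
  have h2 : (fun _ : nat => - (c * 2)) n @[n --> \oo] --> (0 : R).
    by move: h1; under eq_fun do rewrite e.
  have : - (c * 2) = 0 by exact: (cvg_unique _ (cvg_cst _) h2).
  by lra.
have h1 := weak _ (sine_integrable bh).
have e n : \int[mu]_(x in `[0, pi]) (sin x * h x * g n x) = normf n.
  rewrite /normf W_ff /sine_integral; apply: eq_Rintegral => x _.
  by rewrite /g c0 subr0 -mulrA (mulrC (h x)).
by move: h1; under eq_fun do rewrite e.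
Qed.

End Decay.

(** * Evolution of measures *)

Import HBNNSimple.

Section Evolution.
Context {R : realType}.
Local Notation TR := (measurableTypeR R).
Variable a : R.
Hypotheses (a_gt0 : 0 < a) (a_lt : 6 * a < pi).
Local Notation P := (feres_op a).
Local Notation D := (`[0%R, (pi : R)]%classic : set TR).

Let mD : measurable D. Proof. exact: measurable_itv. Qed.

Lemma feres_kernelE (x : R) (A : set TR) : feres_kernel a x A = (P (\1_A) x)%:E.
Proof. by []. Qed.

Lemma feres_op_ge0 (f : R -> R) : (forall x, 0 <= f x) -> forall x, 0 <= P f x.
Proof.
move=> f0 x; rewrite /feres_op !addr_ge0// mulr_ge0//.
- exact: feres_p1_ge0.
- exact: feres_p2_ge0.
- exact: feres_p3_ge0.
- exact: feres_p4_ge0.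
Qed.

Lemma measurable_feres_op (f : R -> R) : measurable_fun [set: TR] f ->
  measurable_fun [set: TR] (P f).
Proof.
move=> mf; rewrite /feres_op.
have mfT (T : TR -> TR) : measurable_fun [set: TR] T ->
    measurable_fun [set: TR] (fun x => f (T x)).
  by move=> mT; exact: measurableT_comp.
apply: measurable_funD; [apply: measurable_funD; [apply: measurable_funD|]|];
  apply: measurable_funM.
- exact: measurable_feres_p1.
- by apply: mfT; exact: measurable_feres_T1.
- exact: measurable_feres_p2.
- by apply: mfT; exact: measurable_feres_T2.
- exact: measurable_feres_p3.
- by apply: mfT; exact: measurable_feres_T3.
- exact: measurable_feres_p4.
- by apply: mfT; exact: measurable_feres_T4.
Qed.

Let mP (f : R -> R) E : measurable_fun [set: TR] f ->
  measurable_fun E (fun x => (P f x)%:E).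
Proof.
by move=> mf; apply/measurable_EFinP; apply: measurable_funTS; exact: measurable_feres_op.
Qed.

Let indic_ge0 (A : set TR) x : (0 : R) <= \1_A x.
Proof. by rewrite indicE. Qed.

(** At fixed x the kernel is a sum of four scaled Dirac masses, so sigma-additivity is inherited
    from the measure structures. *)
Let kernel_bigcup (F : nat -> set TR) (x : R) :
  (forall n, measurable (F n)) -> trivIset setT F ->
  feres_kernel a x (\bigcup_n F n) = (\sum_(n <oo) feres_kernel a x (F n))%E.
Proof.
move=> mF tF.
pose k1 : {measure set TR -> \bar R} :=
  mscale (NngNum (feres_p1_ge0 a_gt0 a_lt x)) (dirac (feres_T1 a x : TR)).
pose k2 : {measure set TR -> \bar R} :=
  mscale (NngNum (feres_p2_ge0 a_gt0 a_lt x)) (dirac (feres_T2 a x : TR)).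
pose k3 : {measure set TR -> \bar R} :=
  mscale (NngNum (feres_p3_ge0 a_gt0 a_lt x)) (dirac (feres_T3 a x : TR)).
pose k4 : {measure set TR -> \bar R} :=
  mscale (NngNum (feres_p4_ge0 a_gt0 a_lt x)) (dirac (feres_T4 a x : TR)).
pose k12 : {measure set TR -> \bar R} := measure_add k1 k2.
pose k123 : {measure set TR -> \bar R} := measure_add k12 k3.
pose k : {measure set TR -> \bar R} := measure_add k123 k4.
have kE A : feres_kernel a x A = k A.
  rewrite [RHS](measure_addE k123 k4) [X in (X + _)%E](measure_addE k12 k3).
  by rewrite [X in (X + _ + _)%E](measure_addE k1 k2) /feres_kernel !EFinD !EFinM.
rewrite kE measure_semi_bigcup//; last exact: bigcupT_measurable.
by apply: eq_eseriesr => n _; rewrite kE.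
Qed.

(** [feres_evolve] yields bare set functions; the integration lemmas need a bundled measure,
    supplied here as a witness with the same values. *)
Lemma feres_evolve_measure (nu : {measure set TR -> \bar R}) (n : nat) :
  exists m : {measure set TR -> \bar R}, m = feres_evolve a nu n :> (set TR -> \bar R).
Proof.
elim: n => [|n [m mE]]; first by exists nu.
pose m' : set TR -> \bar R := fun A => (\int[m]_(x in `[0%R, pi]) feres_kernel a x A)%E.
have m'0 : m' set0 = 0%E.
  rewrite /m' (eq_integral (cst 0%E)) ?integral0// => x _.
  by rewrite feres_kernelE indic0 feres_op_cst.
have m'_ge0 A : (0 <= m' A)%E.
  apply: integral_ge0 => x _; rewrite feres_kernelE lee_fin.
  exact: feres_op_ge0.
have m'_sigma : semi_sigma_additive m'.
  move=> F mF tF mUF.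
  have -> : m' (\bigcup_n F n) = (\sum_(n <oo) m' (F n))%E.
    rewrite /m' -integral_nneseries//.
    - by apply: eq_integral => x _; rewrite kernel_bigcup.
    - by move=> k; apply: mP; exact: measurable_indic.
    - by move=> k x _; rewrite feres_kernelE lee_fin; exact: feres_op_ge0.
  by apply: is_cvg_ereal_nneg_natsum => k _; exact: m'_ge0.
pose mixin := isMeasure.Build _ _ _ m' m'0 m'_ge0 m'_sigma.
exists (HB.pack m' mixin : {measure set TR -> \bar R}).
by rewrite /= /m' mE.
Qed.

Let step_sum (m m' : {measure set TR -> \bar R}) (s : seq R) (A : R -> set TR) :
  (forall B, measurable B -> m' B = (\int[m]_(x in D) feres_kernel a x B)%E) ->
  (forall r, measurable (A r)) -> (forall r, r \in s -> 0 <= r) ->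
  (\int[m']_x (\sum_(r <- s) r * \1_(A r) x)%:E =
   \int[m]_(x in D) (P (fun y => \sum_(r <- s) r * \1_(A r) y) x)%:E)%E.
Proof.
move=> m'E mA; elim: s => [|r s IHs] s0.
  rewrite [LHS]integral0_eq ?[RHS]integral0_eq//.
    move=> x _; under [X in P X]eq_fun do rewrite big_nil.
    by rewrite feres_op_cst.
  by move=> x _; rewrite big_nil.
have r0 : 0 <= r by apply: s0; rewrite inE eqxx.
have {}s0 t : t \in s -> 0 <= t by move=> ts; apply: s0; rewrite inE ts orbT.
have {}IHs := IHs s0.
pose g y := \sum_(r <- s) r * \1_(A r) y.
have g0 y : 0 <= g y.
  by rewrite /g big_seq sumr_ge0// => t ts; apply: mulr_ge0; [exact: s0|exact: indic_ge0].
have mg : measurable_fun [set: TR] g.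
  by apply: measurable_sum => t; apply: measurable_funM => //; exact: measurable_indic.
have -> : (fun x => (\sum_(r <- r :: s) r * \1_(A r) x)%:E) =
    (fun x => r%:E * (\1_(A r) x)%:E + (g x)%:E)%E.
  by apply/funext => x; rewrite big_cons EFinD EFinM.
have -> : (fun x => (P (fun y => \sum_(r <- r :: s) r * \1_(A r) y) x)%:E) =
    (fun x => r%:E * (P (\1_(A r)) x)%:E + (P g x)%:E)%E.
  apply/funext => x; rewrite -EFinM -EFinD /feres_op !big_cons -!/(g _); congr EFin.
  by ring.
have mi : measurable_fun [set: TR] (\1_(A r) : TR -> R) by exact: measurable_indic.
have mi' : measurable_fun [set: TR] (fun x : TR => (\1_(A r) x)%:E : \bar R).
  exact/measurable_EFinP.
have i0 x : (0 <= r%:E * (\1_(A r) x)%:E)%E by rewrite mule_ge0// lee_fin.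
have iP0 x : (0 <= r%:E * (P (\1_(A r)) x)%:E)%E.
  by rewrite mule_ge0// lee_fin; exact: feres_op_ge0.
have gE0 x : (0 <= (g x)%:E)%E by rewrite lee_fin.
have gP0 x : (0 <= (P g x)%:E)%E by rewrite lee_fin; exact: feres_op_ge0.
have rmi : measurable_fun [set: TR] (fun x : TR => r%:E * (\1_(A r) x)%:E)%E.
  exact: measurable_funeM.
have rmP : measurable_fun D (fun x : TR => r%:E * (P (\1_(A r)) x)%:E)%E.
  by apply: measurable_funeM; exact: mP.
have mgE : measurable_fun [set: TR] (fun x : TR => (g x)%:E) by exact/measurable_EFinP.
rewrite (ge0_integralD _ _ (fun x _ => i0 x) rmi (fun x _ => gE0 x) mgE)//.
rewrite (ge0_integralD _ mD (fun x _ => iP0 x) rmP (fun x _ => gP0 x) (mP (E := D) mg)).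
rewrite IHs; congr (_ + _)%E.
rewrite ge0_integralZl//.
rewrite [RHS]ge0_integralZl//; last 2 first.
- exact: mP.
- by move=> x _; rewrite lee_fin; exact: feres_op_ge0.
by congr (_ * _)%E; rewrite integral_indic// setIT m'E.
Qed.

(** Duality between evolving the law and applying [P]: the definition for indicators, linearity for
    simple functions, monotone convergence for the rest. *)
Lemma integral_feres_step (m m' : {measure set TR -> \bar R}) (f : R -> R) :
  (forall B, measurable B -> m' B = (\int[m]_(x in D) feres_kernel a x B)%E) ->
  measurable_fun [set: TR] f -> (forall x, 0 <= f x) ->
  (\int[m']_x (f x)%:E = \int[m]_(x in D) (P f x)%:E)%E.
Proof.
move=> m'E mf f0.
have mEf : measurable_fun [set: TR] (EFin \o f) by exact/measurable_EFinP.
have Ef0 x : [set: TR] x -> (0 <= (EFin \o f) x)%E by rewrite lee_fin.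
pose f_ := nnsfun_approx measurableT mEf.
have fcvg x : f_ n x @[n --> \oo] --> f x.
  have h := @cvg_nnsfun_approx _ _ _ _ measurableT _ mEf Ef0 x Logic.I.
  by have /fine_cvgP[] := h.
have f_nd x : {homo (fun n => f_ n x) : m n / (m <= n)%N >-> m <= n}.
  by move=> i j ij; exact/lefP/nd_nnsfun_approx.
have step n : (\int[m']_x (f_ n x)%:E = \int[m]_(x in D) (P (f_ n) x)%:E)%E.
  pose s : seq R := finmap.enum_fset (fset_set (range (f_ n))).
  pose A (r : R) : set TR := f_ n @^-1` [set r].
  have mA r : measurable (A r) by exact: measurable_funPTI.
  have fE : f_ n = (fun x => \sum_(r <- s) r * \1_(A r) x) :> (R -> R).
    by apply/funext => x; rewrite {1}fimfunE fsbig_finite.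
  rewrite fE; apply: step_sum => // r.
  by rewrite in_fset_set// inE => -[x _ <-].
have lhs : (\int[m']_x (f x)%:E = limn (fun n => \int[m']_x (f_ n x)%:E))%E.
  rewrite -monotone_convergence//.
  - apply: eq_integral => x _; apply/esym/cvg_lim => //.
    by apply/fine_cvgP; split; [exact: nearW|exact: fcvg].
  - by move=> n; exact/measurable_EFinP.
  - by move=> n x _; rewrite lee_fin.
  - by move=> x _ i j ij; rewrite lee_fin f_nd.
have rhs : (\int[m]_(x in D) (P f x)%:E = limn (fun n => \int[m]_(x in D) (P (f_ n) x)%:E))%E.
  rewrite -monotone_convergence//.
  - apply: eq_integral => x _; apply/esym/cvg_lim => //.
    apply/fine_cvgP; split; first exact: nearW.
    rewrite /feres_op; apply: cvgD; [apply: cvgD; [apply: cvgD|]|].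
    + exact: (cvgMl_tmp (fcvg _)).
    + exact: (cvgMl_tmp (fcvg _)).
    + exact: (cvgMl_tmp (fcvg _)).
    + exact: (cvgMl_tmp (fcvg _)).
  - by move=> n; apply: mP; exact: measurable_funP.
  - by move=> n x _; rewrite lee_fin; exact: feres_op_ge0.
  - move=> x _ i j ij; rewrite lee_fin /feres_op !lerD// ler_wpM2l ?f_nd//.
    + exact: feres_p1_ge0.
    + exact: feres_p2_ge0.
    + exact: feres_p3_ge0.
    + exact: feres_p4_ge0.
by rewrite lhs rhs; congr (limn _); apply/funext => n; exact: step.
Qed.

Lemma feres_op_restrict (f g : R -> R) (x : R) :
  (forall y, 0 <= y <= pi -> f y = g y) -> 0 <= x <= pi -> P f x = P g x.
Proof.
move=> fg xpi; rewrite /feres_op.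
have key (p y : R) : (p != 0 -> 0 <= y <= pi) -> p * f y = p * g y.
  by move=> py; have [->|/py/fg ->//] := eqVneq p 0; rewrite !mul0r.
by congr (_ + _ + _ + _); apply: key => ?;
  [exact: feres_T1_stays|exact: feres_T2_stays|exact: feres_T3_stays|exact: feres_T4_stays].
Qed.

(** The one-step duality integrates over the whole line on one side, so the integrand is truncated
    to [D] before each step; [feres_op_restrict] removes the truncation, because no open branch
    leaves [0, pi]. *)
Lemma feres_evolveE (nu : {measure set TR -> \bar R}) (n : nat) (A : set TR) :
  measurable A -> A `<=` D ->
  feres_evolve a nu n A = (\int[nu]_(x in D) (iter n P (\1_A) x)%:E)%E.
Proof.
move=> mA AD.
have restr (m : {measure set TR -> \bar R}) (f : R -> R) :
    (\int[m]_(x in D) (f x)%:E = \int[m]_x ((f \_ D) x)%:E)%E.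
  by rewrite integral_mkcond; apply: eq_integral => x _; rewrite /patch; case: ifP.
have key k (f : R -> R) (m : {measure set TR -> \bar R}) :
    m = feres_evolve a nu k :> (set TR -> \bar R) ->
    measurable_fun [set: TR] f -> (forall x, 0 <= f x) ->
    (\int[m]_(x in D) (f x)%:E = \int[nu]_(x in D) (iter k P f x)%:E)%E.
  elim: k f m => [|k IHk] f m mE mf f0.
    by apply: eq_measure_integral => B mB _; rewrite mE.
  have [m0 m0E] := feres_evolve_measure nu k.
  rewrite restr (@integral_feres_step m0).
  - rewrite iterSr -(IHk _ m0 m0E); [|exact: measurable_feres_op|exact: feres_op_ge0].
    apply: eq_integral => x; rewrite inE /= in_itv/= => xpi; congr EFin.
    apply: feres_op_restrict => // y ypi.
    by rewrite /patch mem_setE in_itv/= ypi.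
  - by move=> B mB; rewrite mE /= m0E.
  - by apply/(measurable_restrictT _ mD); exact: measurable_funTS.
  - by move=> x; rewrite /patch; case: ifP.
have m1 : measurable_fun [set: TR] (\1_A : TR -> R) by exact: measurable_indic.
case: n => [|n]; first by rewrite /= integral_indic// setIidl.
have [m mE] := feres_evolve_measure nu n.
have -> : feres_evolve a nu n.+1 A = (\int[m]_(x in D) (P (\1_A) x)%:E)%E.
  by rewrite /= -mE.
under [RHS]eq_integral do rewrite iterSr.
by apply: key => //; [exact: measurable_feres_op|exact: feres_op_ge0].
Qed.
End Evolution.

(** * Convergence and its failure *)

Section Main.
Context {R : realType}.
Local Notation mu := (@lebesgue_measure R).
Local Notation TR := (measurableTypeR R).
Local Notation W := (@sine_integral R).
Local Notation D := (`[0%R, (pi : R)]%classic : set TR).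
Variable a : R.
Hypotheses (a_gt0 : 0 < a) (a_lt : 6 * a < pi).
Local Notation P := (feres_op a).

Let mD : measurable D. Proof. exact: measurable_itv. Qed.

Lemma feres_muE (A : set TR) : measurable A -> feres_mu A = (W (\1_A) / 2)%:E.
Proof.
move=> mA; rewrite /feres_mu mulrC EFinM; congr (_ * _)%E.
have bA : bounded_measurable (\1_A : R -> R) by exact: bounded_measurable_indic.
rewrite /sine_integral /Rintegral fineK; last first.
  by apply: integrable_fin_num => //; exact: sine_integrable.
rewrite integral_mkcondl; apply: eq_integral => x _.
by rewrite /patch indicE; case: ifP => _; rewrite ?mulr1 ?mulr0.
Qed.

Lemma lebesgue_dominates_feres_mu (nu : {measure set TR -> \bar R}) :
  nu `<< @feres_mu R -> nu `<< mu.
Proof.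
move=> numu; apply: null_dominates_trans numu _ => B Bnull A mA AB.
have A0 : mu A = 0%E by exact: Bnull.
rewrite /feres_mu (_ : (\int[_]_(_ in _) _)%E = 0%E) ?mule0//.
apply: null_set_integral.
- exact: measurableI.
- by apply/measurable_EFinP; apply: measurable_funTS; exact: measurable_sin.
- by apply: (subset_measure0 _ mA _ A0); [exact: measurableI|exact: subIsetl].
Qed.

(** The sine is positive inside [0, pi]. The weighted-square lemma is applied to the indicator,
    whose weighted square is 0 and hence below every threshold. *)
Lemma feres_mu_null (A : set TR) : measurable A -> feres_mu A = 0%E ->
  mu (A `&` D) = 0%E.
Proof.
move=> mA; rewrite feres_muE// => -[WA].
have {}WA : W (\1_A) = 0 by lra.
have bA : bounded_measurable (\1_A : R -> R) by exact: bounded_measurable_indic.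
have I0 e : 0 < e -> \int[mu]_(x in D) \1_A x < e.
  move=> e0.
  have [delta delta0 H] := @small_of_weighted_square_itv R 0 pi (fun t => sin t) (fun=> 1) 1
    bounded_measurable_sin (measurable_cst _) (fun t => @sin_gt0_pi R t) (fun _ _ => ler01)
    (bounded_itv_integrable _ _ (bounded_measurable_cst _)) e e0.
  have := H (\1_A) bA.1; rewrite /W.
  have -> : \int[mu]_(x in `[0, pi]) (sin x * \1_A x ^+ 2) = 0.
    transitivity (W (\1_A)); last exact: WA.
    apply: eq_Rintegral => x _; congr (_ * _).
    by rewrite indicE; case: (_ \in _); rewrite ?expr1n ?expr0n.
  have -> : \int[mu]_(x in `[0, pi]) (1 * `|\1_A x|) = \int[mu]_(x in D) \1_A x.
    by apply: eq_Rintegral => x _; rewrite mul1r ger0_norm// indicE.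
  apply=> // x; rewrite indicE; case: (_ \in _); rewrite ?normr1 ?normr0//.
have fin : mu (A `&` D) \is a fin_num.
  have [_ fD] := finite_measurable_itv (0 : R) pi.
  rewrite ge0_fin_numE//; apply: le_lt_trans fD.
  by apply: le_measure; rewrite ?inE//; exact: measurableI.
have e : \int[mu]_(x in D) \1_A x = fine (mu (A `&` D)).
  by rewrite /Rintegral integral_indic.
rewrite -(fineK fin) -e; congr EFin; apply/eqP; rewrite eq_le; apply/andP; split.
  by apply/ler_addgt0Pr => x x0; rewrite add0r ltW// I0.
by rewrite e fine_ge0.
Qed.

Lemma feres_evolve_cvg (nu : probability TR R) (A : set TR) :
  irrational (a / pi) -> nu D = 1%E -> nu `<< @feres_mu R ->
  measurable A -> A `<=` D ->
  feres_evolve a nu n A @[n --> \oo] --> feres_mu A.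
Proof.
move=> irr nuD numu' mA AD.
have numu : nu `<< mu by exact: lebesgue_dominates_feres_mu.
rewrite feres_muE//; set m := W _ / 2.
have bA : bounded_measurable (\1_A : R -> R) by exact: bounded_measurable_indic.
have A01 (x : R) : 0 <= (\1_A x : R) <= 1.
  by rewrite indicE; case: (_ \in _); rewrite /= ?lexx ?ler01.
have m01 : 0 <= m <= 1.
  have bc (c : R) : bounded_measurable (fun=> c) by exact: bounded_measurable_cst.
  have := le_sine_integral (bc 0) bA (fun x _ => proj1 (andP (A01 x))).
  have := le_sine_integral bA (bc 1) (fun x _ => proj2 (andP (A01 x))).
  by rewrite !sine_integral_cst /m => h1 h2; apply/andP; split; lra.
pose h (x : R) := \1_A x - m.
have bh : bounded_measurable h.
  by apply: bounded_measurableB => //; exact: bounded_measurable_cst.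
have h1 x : `|h x| <= 1.
  move: (A01 x) m01 => /andP[? ?] /andP[? ?].
  by rewrite ler_norml /h; apply/andP; split; lra.
have hmean : W h = 0.
  rewrite sine_integralB//; last exact: bounded_measurable_cst.
  by rewrite sine_integral_cst /m; lra.
have iterE n : iter n P h = (fun x => iter n P (\1_A) x - m).
  elim: n => [|n IHn] //=; rewrite IHn feres_opB.
  by rewrite (feres_op_cst a_gt0 a_lt).
have decay := sine_norm_iter_cvg0 a_gt0 a_lt irr bh h1 hmean.
have bit n : bounded_measurable (iter n P h) by exact: bounded_measurable_iter.
have it1 n x : `|iter n P h x| <= 1.
  by elim: n x => [|n IHn] //=; exact: feres_op_norm_le.
have nu_int (f : R -> R) : bounded_measurable f -> nu.-integrable D (EFin \o f).
  move=> bf; apply: measurable_bounded_integrable => //.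
  - by apply: le_lt_trans (probability_le1 nu mD) _; rewrite ltry.
  - by apply: measurable_funTS; case: bf.
  - exact: bounded_measurable_bounded.
(* As [nu] gives [D] mass 1, the constant m integrates to itself and the error is the mean of the
   centred iterate. *)
have evE n : feres_evolve a nu n A = (\int[nu]_(x in D) iter n P h x + m)%:E.
  rewrite feres_evolveE// (_ : m = \int[nu]_(x in D) m); last first.
    by rewrite Rintegral_cst// [X in fine X]nuD mulr1.
  rewrite -RintegralD//; [|exact: nu_int|by apply: nu_int; exact: bounded_measurable_cst].
  rewrite /Rintegral fineK.
    by apply: eq_integral => x _; rewrite iterE subrK.
  apply: integrable_fin_num => //; apply: nu_int; apply: bounded_measurableD => //.
  exact: bounded_measurable_cst.
under eq_fun do rewrite evE.
suff lim0 : \int[nu]_(x in D) iter n P h x @[n --> \oo] --> (0 : R).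
  apply/fine_cvgP; split; first exact: nearW.
  have := cvgD lim0 (cvg_cst m); rewrite add0r; exact.
(* The density is taken with respect to Lebesgue measure; its modulus serves as v in the
   weighted-square lemma, with sin as the degenerate weight. *)
pose rn := Radon_Nikodym (charge_of_finite_measure nu) mu.
have irn : mu.-integrable [set: TR] rn by exact: Radon_Nikodym_integrable.
pose v (x : R) := `|fine (rn x)|.
have rnE x : rn x = (fine (rn x))%:E by rewrite fineK//; exact: Radon_Nikodym_fin_num.
have mrn : measurable_fun [set: TR] (fun x => fine (rn x)).
  by apply: (measurableT_comp (fine_measurable _)) => //; exact: measurable_int irn.
have mv : measurable_fun [set: TR] v by exact: measurableT_comp.
have irnD : mu.-integrable D (EFin \o (fun x => fine (rn x))).
  apply: (eq_integrable mD rn); first by move=> x _; rewrite rnE.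
  exact: (integrableS measurableT mD (@subsetT _ _) irn).
have iv : mu.-integrable D (EFin \o v) by exact: integrable_norm.
have chg n : \int[nu]_(x in D) iter n P h x = \int[mu]_(x in D) (fine (rn x) * iter n P h x).
  rewrite /Rintegral; congr fine.
  rewrite -(Radon_Nikodym_change_of_variables numu mD (nu_int _ (bit n))).
  by apply: eq_integral => x _; rewrite -/rn /= rnE -EFinM mulrC.
apply/cvgrPdist_lt => e e0.
have [delta delta0 H] := @small_of_weighted_square_itv R 0 pi (fun t => sin t) v 1
  bounded_measurable_sin mv (fun t => @sin_gt0_pi R t) (fun _ _ => normr_ge0 _) iv e e0.
have /cvgrPdist_lt/(_ _ delta0)[N _ HN] := decay.
exists N => // n Nn /=; rewrite sub0r normrN chg.
have iprod := integrable_mul_bounded mD irnD (bit n).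
apply: (le_lt_trans (le_normr_Rintegral mD iprod)).
under eq_Rintegral do rewrite normrM.
apply: H; [exact: (bit n).1|exact: it1|].
have := HN n Nn; rewrite /= sub0r normrN; apply: le_lt_trans.
apply: (le_trans _ (ler_norm _)); rewrite le_eqVlt; apply/orP; left; apply/eqP.
by apply: eq_Rintegral => x _; rewrite expr2.
Qed.
End Main.

(** * Failure of convergence for rational alpha / pi *)

Section Rational.
Context {R : realType}.
Local Notation mu := (@lebesgue_measure R).
Local Notation TR := (measurableTypeR R).
Local Notation D := (`[0%R, (pi : R)]%classic : set TR).

Lemma cosD_natmul2pi (x : R) (n : nat) : cos (x + n%:R * (2 * pi)) = cos x.
Proof. by rewrite mulr_natl [2 * pi]mulr_natl (periodicn (@cosD2pi R)). Qed.

Lemma uniform_prob_dominated (b c : R) (bc : b < c) : 0 <= b -> c <= pi ->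
  uniform_prob bc `<< @feres_mu R.
Proof.
move=> b0 cpi B Bnull A mA AB.
have A0 : feres_mu A = 0%E by exact: Bnull.
have AD0 := feres_mu_null mA A0.
have mI : measurable (A `&` `[b, c]%classic : set TR) by exact: measurableI.
have I0 : mu (A `&` `[b, c]) = 0%E.
  apply: (subset_measure0 mI (measurableI _ _ mA (measurable_itv _)) _ AD0).
  apply: setIS => x /=; rewrite !in_itv/= => /andP[/(le_trans b0) -> xc].
  exact: le_trans cpi.
rewrite /uniform_prob integral_uniform_pdf.
exact: (proj1 (null_content_dominatesP (uniform_prob bc) mu) (dominates_uniform_prob bc) _ mI I0).
Qed.

Variables (a : R) (p q : nat).
Hypotheses (a_gt0 : 0 < a) (a_lt : 6 * a < pi) (q_gt0 : (0 < q)%N).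
Hypothesis a_rat : q%:R * a = p%:R * pi.
Local Notation P := (feres_op a).

Let C : set TR := [set x | 0 < cos (q%:R * x)].
Let B : set TR := C `&` D.

Let mC : measurable C.
Proof.
have mq : measurable_fun [set: TR] (fun x : TR => cos (q%:R * x) : R).
  apply: (measurableT_comp (@measurable_cos R)).
  exact: measurable_funM.
have := measurable_fun_ltr (measurable_cst (0 : R)) mq.
move=> /(_ measurableT [set true] Logic.I); rewrite setTI.
congr (measurable _); apply/seteqP; split => x /=; by case: (_ < _).
Qed.

Let mB : measurable B. Proof. by apply: measurableI => //; exact: measurable_itv. Qed.

(** After multiplication by q, a shift by 2 alpha becomes p full turns, and the reflections are
    absorbed by evenness of the cosine. *)
Let cosT x : [/\ cos (q%:R * feres_T1 a x) = cos (q%:R * x),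
  cos (q%:R * feres_T2 a x) = cos (q%:R * x),
  cos (q%:R * feres_T3 a x) = cos (q%:R * x) &
  cos (q%:R * feres_T4 a x) = cos (q%:R * x)].
Proof.
have e : q%:R * (2 * a) = p%:R * (2 * pi) by rewrite mulrCA a_rat; ring.
split.
- by rewrite /feres_T1 mulrDr e cosD_natmul2pi.
- rewrite -[RHS]cosN -[RHS](cosD_natmul2pi _ q) -[LHS](cosD_natmul2pi _ (p + p)).
  congr (cos _); rewrite /feres_T2 natrD (mulrDl p%:R) -e; ring.
- rewrite -[LHS](cosD_natmul2pi _ p) -e; congr (cos _).
  by rewrite /feres_T3; ring.
- rewrite -[RHS]cosN -[RHS](cosD_natmul2pi _ (p + p)); congr (cos _).
  by rewrite natrD (mulrDl p%:R) -e /feres_T4; ring.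
Qed.

Let P_C (x : R) : P (\1_C) x = \1_C x.
Proof.
have [e1 e2 e3 e4] := cosT x.
have CE (y : R) : cos (q%:R * y) = cos (q%:R * x) -> \1_C y = \1_C x :> R.
  move=> e; rewrite !indicE; congr (nat_of_bool _)%:R.
  by apply/idP/idP; rewrite !inE /C /= e.
rewrite /feres_op !CE// -!mulrDl.
by rewrite (feres_p_sum a_gt0 a_lt) mul1r.
Qed.

Let BC (y : R) : 0 <= y <= pi -> \1_B y = \1_C y :> R.
Proof.
move=> ypi; rewrite !indicE; congr (nat_of_bool _)%:R.
have yD : y \in D by rewrite inE /= in_itv.
by rewrite /B in_setI yD andbT.
Qed.

(** The indicator of [C] is fixed by [P] on the whole line, that of the truncated set [B] only on
    [0, pi]; each step passes through [C]. *)
Let iter_B n (x : R) : 0 <= x <= pi -> iter n P (\1_B) x = \1_B x.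
Proof.
elim: n x => [//|n IHn] x xpi /=.
rewrite (feres_op_restrict a_gt0 a_lt (g := \1_C)) ?P_C ?BC// => y ypi.
by rewrite IHn// BC.
Qed.

Lemma feres_evolve_invariant (nu : {measure set TR -> \bar R}) n :
  feres_evolve a nu n B = nu B.
Proof.
rewrite (feres_evolveE a_gt0 a_lt)//; last exact: subIsetr.
rewrite (eq_integral (fun x => (\1_B x)%:E)); last first.
  by move=> x; rewrite inE /= in_itv/= => xpi; rewrite iter_B.
by rewrite integral_indic// setIidl//; exact: subIsetr.
Qed.

Let qR : 0 < q%:R :> R. Proof. by rewrite ltr0n. Qed.

Let third : 0 < pi / (3 * q%:R) :> R.
Proof. by rewrite divr_gt0 ?pi_gt0// mulr_gt0. Qed.

Let two_third : 2 * (pi / (3 * q%:R)) < 3 * (pi / (3 * q%:R)) :> R.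
Proof. by rewrite ltr_pM2r// ltr_nat. Qed.

Let third_le : 3 * (pi / (3 * q%:R)) <= pi :> R.
Proof.
rewrite (_ : 3 * (pi / (3 * q%:R)) = pi / q%:R).
  by rewrite ler_pdivrMr// ler_peMr ?pi_ge0// ler1n.
by rewrite invfM mulrA mulrCA mulrA; field; rewrite gt_eqF.
Qed.

Lemma feres_not_mixing :
  ~ (forall nu : probability TR R, nu D = 1%E -> nu `<< @feres_mu R ->
     forall A : set TR, measurable A -> A `<=` D ->
       feres_evolve a nu n A @[n --> \oo] --> feres_mu A).
Proof.
move=> mixing.
have := third; have := two_third; have := third_le.
(* On [0, t] the angle q x is at most pi / 3, on [2 t, 3 t] it lies in [2 pi / 3, pi]. The uniform
   laws on these intervals therefore give [B] mass 1 and 0, while convergence would force both to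
   equal its [feres_mu] mass. *)
set t := pi / (3 * q%:R) => t_le t23 t_gt0.
have qt : q%:R * t = pi / 3 by rewrite /t; field; rewrite gt_eqF.
have BD : B `<=` D by exact: subIsetr.
have inv (nu : probability TR R) : nu D = 1%E -> nu `<< @feres_mu R ->
    feres_mu B = nu B.
  move=> nuD numu; have := mixing nu nuD numu B mB BD.
  under eq_fun do rewrite feres_evolve_invariant.
  by move=> lim; exact: (cvg_unique (@ereal_hausdorff R) lim (cvg_cst _)).
have t_pi : t <= pi by lra.
have h1 : (uniform_prob t_gt0 B = 1)%E.
  apply: integral_uniform_pdf1 => // x /=; rewrite in_itv/= => /andP[x0 xt].
  split; last by rewrite /= in_itv/= x0 (le_trans xt).
  have qx : q%:R * x <= pi / 3 by rewrite -qt ler_pM2l.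
  have qx0 : 0 <= q%:R * x by rewrite mulr_ge0.
  by rewrite /C /=; apply: cos_gt0_pihalf; have := pi_gt0 R => ?; apply/andP; split; lra.
have h2 : (uniform_prob t23 B = 0)%E.
  rewrite /uniform_prob integral_uniform_pdf (_ : B `&` _ = set0) ?integral_set0//.
  rewrite -subset0 => x [[Cx _]] /=; rewrite in_itv/= => /andP[tx xt].
  have qx1 : 2 * (pi / 3) <= q%:R * x by rewrite -qt mulrCA ler_pM2l.
  have qx2 : q%:R * x <= pi.
    by rewrite [leRHS](_ : _ = q%:R * (3 * t)) ?ler_pM2l// mulrCA qt; lra.
  move: Cx; rewrite /C /= -(subrK pi (q%:R * x)) cosDpi oppr_gt0 ltNge => /negP; apply.
  by apply: cos_ge0_pihalf; have := pi_gt0 R => ?; apply/andP; split; lra.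
have D1 : (uniform_prob t_gt0 D = 1)%E.
  apply: integral_uniform_pdf1 => // x /=; rewrite !in_itv/= => /andP[-> xt].
  exact: le_trans t_pi.
have D2 : (uniform_prob t23 D = 1)%E.
  apply: integral_uniform_pdf1 => // x /=; rewrite !in_itv/= => /andP[tx xt].
  by apply/andP; split; lra.
have i1 : feres_mu B = uniform_prob t_gt0 B.
  by apply: inv => //; exact: uniform_prob_dominated.
have i2 : feres_mu B = uniform_prob t23 B.
  by apply: inv => //; apply: uniform_prob_dominated => //; lra.
by move: i2; rewrite i1 h1 h2 => /eqP; rewrite onee_eq0.
Qed.

End Rational.

(** The quantifier over [nu] belongs to the left-hand side: for rational alpha / pi a particular
    law, such as the invariant one, can still converge. *)
Theorem theorem3p11 (R : realType) (alpha : R)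
    (halpha : 0 < alpha < pi / 6) :
  (forall nu : probability (measurableTypeR R) R,
     nu `[0, pi]%classic = 1%E ->
     nu `<< @feres_mu R ->
     forall A : set (measurableTypeR R), measurable A -> A `<=` `[0, pi] ->
       feres_evolve alpha nu n A @[n --> \oo] --> feres_mu A)
  <-> @irrational R (alpha / pi).
Proof.
have /andP[a0 a6] := halpha.
have al : 6 * alpha < pi by lra.
split=> [mixing /rationalP[k [q e]]|irr nu nuD numu A mA AD]; last first.
  exact: feres_evolve_cvg.
have pi0 : 0 < pi :> R by exact: pi_gt0.
have api : 0 < alpha / pi by rewrite divr_gt0.
(* A zero denominator would make the quotient 0 by convention, against positivity of alpha / pi. *)
have q0 : (0 < q)%N.
  by case: q e => // e; move: api; rewrite e invr0 mulr0 ltxx.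
have qR : 0 < q%:R :> R by rewrite ltr0n.
have k0 : 0 < k.
  by move: api; rewrite e pmulr_lgt0 ?invr_gt0// ltr0z.
have [p kp] : exists p : nat, k = p%:Z by exists `|k|%N; rewrite gtz0_abs.
apply: (@feres_not_mixing R alpha p q a0 al q0 _ mixing).
have := congr1 (fun x => q%:R * pi * x) e; rewrite /= kp.
have qn : q%:R != 0 :> R by rewrite gt_eqF.
have pn : (pi : R) != 0 by rewrite gt_eqF.
have -> : q%:R * pi * (alpha / pi) = q%:R * alpha.
  by move: (pi : R) pn => w wn; field.
by move=> ->; move: (pi : R) pn => w wn; rewrite -pmulrn; field.
Qed.
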